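(* Let $(\overline W_{n_1,\dots,n_r})$ be the collection of formal functions $\overline W_{n_1,\dots,n_r}\in(U_q(\mathfrak b_+)/J)[[u^{(s)}_j\mid 1\le s\le r,1\le j\le n_s]]$ attached to the universal weight function $\bar I\mapsto W_{\bar I}$ (see the context). Let $s,t\in\{1,\dots,r\}$ with $s\ne t$, let $m:=1-a_{s,t}$, let $k_1,\dots,k_m\in\{1,\dots,n_s\}$ be distinct and let $l\in\{1,\dots,n_t\}$. Let $H^{st}_{(k_1,\dots,k_m),l}\subset\oplus_{s'=1}^r\mathbb C^{n_{s'}}$ be the subspace of all $(u^{(s')}_j)_{s'\in\{1,\dots,r\},\,j\in\{1,\dots,n_{s'}\}}$ such that $$u^{(t)}_l=q^{-\frac{(m-1)(\alpha_s,\alpha_s)}2}u^{(s)}_{k_1}=q^{-\frac{(m-3)(\alpha_s,\alpha_s)}2}u^{(s)}_{k_2}=\cdots=q^{\frac{(m-1)(\alpha_s,\alpha_s)}2}u^{(s)}_{k_m}.$$ Then the restriction of $\overline W_{n_1,\dots,n_r}$ to $H^{st}_{(k_1,\dots,k_m),l}$ is identically zero.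
   Context: Algebra. $q\in\mathbb C^\times$ is not a root of unity. $\mathfrak g$ is a simple complex Lie algebra of rank $r$ with simple roots $\Pi=\{\alpha_1,\dots,\alpha_r\}$ and highest root $\theta$; $\widehat{\mathfrak g}$ is its untwisted affine Lie algebra with simple roots $\alpha_0,\dots,\alpha_r$, Cartan matrix $(a_{i,j})_{0\le i,j\le r}$ (whose restriction to indices $1,\dots,r$ is the Cartan matrix of $\mathfrak g$), symmetrized form $(\alpha_i,\alpha_j)=d_ia_{i,j}$ ($d_i\in\{1,2,3\}$ coprime), minimal positive imaginary root $\delta=\sum_{i=0}^rn_i\alpha_i$, $n_0=1$. $q_i=q_{\alpha_i}=q^{d_i}$, $[n]_q=\frac{q^n-q^{-n}}{q-q^{-1}}$. $U_q(\widehat{\mathfrak g})$ is generated by $e_{\pm\alpha_i},k_{\alpha_i}^{\pm1}$ ($0\le i\le r$), $q^{\pm d}$ and central $k_\delta^{\pm1/2}$ with $(k_\delta^{1/2})^2=\prod k_{\alpha_i}^{n_i}$ and relations: the $k$'s and $q^d$ commute (with $x x^{-1}=1$), $q^de_{\pm\alpha_i}q^{-d}=q^{\pm\delta_{i,0}}e_{\pm\alpha_i}$, $k_{\alpha_i}e_{\pm\alpha_j}k_{\alpha_i}^{-1}=q_i^{\pm a_{ij}}e_{\pm\alpha_j}$, $[e_{\alpha_i},e_{-\alpha_j}]=\delta_{ij}\frac{k_{\alpha_i}-k_{\alpha_i}^{-1}}{q_i-q_i^{-1}}$, and the quantum Serre relations $\sum_{p+s=1-a_{ij}}(-1)^pe_{\pm\alpha_i}^{(p)}e_{\pm\alpha_j}e_{\pm\alpha_i}^{(s)}=0$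 ($i\ne j$, $e^{(p)}_{\pm\alpha_i}=e_{\pm\alpha_i}^p/[p]_{q_i}!$). The counit $\varepsilon$ is $0$ on $e_{\pm\alpha_i}$, $1$ on the $k$'s and $q^d$. Currents presentation. $U_q(\widehat{\mathfrak g})$ is also generated by central $C^{\pm1}$, $q^{\pm d}$, and $e_\alpha[n],f_\alpha[n]$ ($n\in\mathbb Z$), $k_\alpha^{\pm1}$, $h_\alpha[n]$ ($n\ne0$), $\alpha\in\Pi$, collected as $e_\alpha(z)=\sum_n e_\alpha[n]z^{-n}$, $f_\alpha(z)=\sum_nf_\alpha[n]z^{-n}$, $\psi^\pm_\alpha(z)=\sum_{n\ge0}\psi^\pm_\alpha[\pm n]z^{\mp n}=k_\alpha^{\pm1}\exp(\pm(q_\alpha-q_\alpha^{-1})\sum_{n>0}h_\alpha[\pm n]z^{\mp n})$, with $q^da(z)q^{-d}=a(q^{-1}z)$ for these currents and relations, for $\alpha,\beta\in\Pi$, $a=(\alpha,\beta)$: $(z-q^{a}w)e_\alpha(z)e_\beta(w)=(q^az-w)e_\beta(w)e_\alpha(z)$; $(z-q^{-a}w)f_\alpha(z)f_\beta(w)=(q^{-a}z-w)f_\beta(w)f_\alpha(z)$; $\psi^\pm_\alpha(z)e_\beta(w)\psi^\pm_\alpha(z)^{-1}=\frac{q^aC^{\pm1}z-w}{C^{\pm1}z-q^aw}e_\beta(w)$; $\psi^\pm_\alpha(z)f_\beta(w)\psi^\pm_\alpha(z)^{-1}=\frac{q^{-a}C^{\mp1}z-w}{C^{\mp1}z-q^{-a}w}f_\beta(w)$;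 $\psi^\pm_\alpha(z)\psi^\pm_\beta(w)=\psi^\pm_\beta(w)\psi^\pm_\alpha(z)$; $\frac{q^az-C^2w}{z-q^aC^2w}\psi^+_\alpha(z)\psi^-_\beta(w)=\frac{q^aC^2z-w}{C^2z-q^aw}\psi^-_\beta(w)\psi^+_\alpha(z)$; $[e_\alpha(z),f_\beta(w)]=\frac{\delta_{\alpha,\beta}}{q_\alpha-q_\alpha^{-1}}(\delta(z/C^2w)\psi^+_\alpha(C^{-1}z)-\delta(C^2z/w)\psi^-_\alpha(C^{-1}w))$, $\delta(z)=\sum_{k\in\mathbb Z}z^k$; and the quantum Serre relations for the currents $e_{\alpha_i}(z)$ and, separately, $f_{\alpha_i}(z)$: $\sum_{p=0}^{m}(-1)^p\binom{m}{p}_{q_i}\mathrm{Sym}_{z_1,\dots,z_m}x_i(z_1)\cdots x_i(z_p)x_j(w)x_i(z_{p+1})\cdots x_i(z_m)=0$, $m=1-a_{i,j}$, $i\ne j$. The identification is: $k_{\alpha_i}\mapsto k_{\alpha_i}$, $e_{\alpha_i}\mapsto e_{\alpha_i}[0]$, $e_{-\alpha_i}\mapsto f_{\alpha_i}[0]$ ($1\le i\le r$), $k_\delta^{1/2}\mapsto C$, $q^d\mapsto q^d$, $k_{\alpha_0}\mapsto C^2\prod_{i\ge1}k_{\alpha_i}^{-n_i}$, and, if $[e_{\alpha_{i_1}},[\cdots,[e_{\alpha_{i_n}},e_{\alpha_j}]\cdots]]$ is a nonzero multiple of the root vector $e_\theta\in\mathfrak g$, $e_{\alpha_0}\mapsto\mu\,S^-_{i_1}\cdots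 S^-_{i_n}(f_{\alpha_j}[1])k_{\alpha_0}$, $e_{-\alpha_0}\mapsto\lambda\,k_{\alpha_0}^{-1}S^+_{i_1}\cdots S^+_{i_n}(e_{\alpha_j}[-1])$, where $S_i^+(x)=e_{\alpha_i}[0]x-k_{\alpha_i}xk_{\alpha_i}^{-1}e_{\alpha_i}[0]$, $S_i^-(x)=xf_{\alpha_i}[0]-f_{\alpha_i}[0]k_{\alpha_i}xk_{\alpha_i}^{-1}$ and $\lambda,\mu\neq0$ are scalars such that the relation for $[e_{\alpha_0},e_{-\alpha_0}]$ holds. Subalgebras. $U_q(\mathfrak h)$: generated by the $k_{\alpha_i}^{\pm1}$ ($0\le i\le r$), $k_\delta^{\pm1/2}$, $q^{\pm d}$. $U_q(\mathfrak n_\pm)$: generated by $e_{\pm\alpha_i}$, $0\le i\le r$; $U_q(\mathfrak b_\pm)$: generated by $U_q(\mathfrak n_\pm)$ and $U_q(\mathfrak h)$. $U_F$: generated by $U_q(\mathfrak h)$, $f_\alpha[n]$ ($n\in\mathbb Z$), $h_\alpha[m]$ ($m>0$). $U_f^-=U_F\cap U_q(\mathfrak n_-)$, $U_F^+=U_F\cap U_q(\mathfrak b_+)$. The product gives a linear isomorphism $U_f^-\otimes U_F^+\simeq U_F$, and $P:U_F\to U_F^+$ is the linear map $P(f_-f_+)=\varepsilon(f_-)f_+$ ($f_-\in U_f^-$, $f_+\in U_F^+$), applied coefficientwise to series. $J=\sum_{\alpha\in\Pi,n\ge0}U_q(\mathfrak b_+)e_\alpha[n]$, a left ideal of $U_q(\mathfrak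 b_+)$. Weight functions. An ordered $\Pi$-multiset is a triple $\bar I=(I,\prec,\iota)$ with $(I,\prec)$ a finite totally ordered set and $\iota:I\to\Pi$. For $I=\{i_1\prec\cdots\prec i_n\}$, $W_{\bar I}((t_i)_{i\in I}):=P(f_{\iota(i_1)}(t_{i_1})\cdots f_{\iota(i_n)}(t_{i_n}))$, with coefficients viewed in $U_q(\mathfrak b_+)/J$; it lies in $(U_q(\mathfrak b_+)/J)((t_{i_n}^{-1}))\cdots((t_{i_1}^{-1}))$, the space of series $\sum A_{k_1,\dots,k_n}t_{i_1}^{k_1}\cdots t_{i_n}^{k_n}$ with $A_{k_1,\dots,k_n}=0$ whenever $k_1>a_1$, or $k_2>a_2(k_1)$, ..., or $k_n>a_n(k_1,\dots,k_{n-1})$, for some integer $a_1$ and integer valued functions $a_2,\dots,a_n$. The $\overline W_{n_1,\dots,n_r}$ are the formal power series, symmetric in each group of variables $(u_j^{(s)})_{j=1,\dots,n_s}$, such that for every $\bar I$ $$W_{\bar I}((t_i)_{i\in I})=\frac{\epsilon(\sigma)\prod_{s=1}^r\prod_{i,j\in I_s\mid i\prec j}(t_i^{-1}-t_j^{-1})}{\prod_{i\in I}t_i\prod_{i,j\in I\mid i\prec j}(t_i^{-1}-q^{(\iota(i),\iota(j))}t_j^{-1})}\ \overline W_{|I_1|,\dots,|I_r|}\big((t_{j_1}^{-1})_{j_1\in I_1},\dots,(t_{j_r}^{-1})_{j_r\in I_r}\big)$$ in this space, where $I_s=\iota^{-1}(\alpha_s)$ and $\epsilon(\sigma)$ is the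 sign of the shuffle permutation $\{1,\dots,n\}\simeq I_1\sqcup\cdots\sqcup I_r\to I\simeq\{1,\dots,n\}$ (first and last bijections ordered, with $I_1\prec\cdots\prec I_r$ in the disjoint union, and the middle map the natural injection on each $I_s$). *)

(* Defs.v *)
From HB Require Import structures.
From mathcomp Require Import all_boot all_order all_algebra all_fingroup.
From mathcomp Require Import boolp classical_sets fsbigop reals.
From mathcomp Require Import complex.

Set Implicit Arguments.
Unset Strict Implicit.
Unset Printing Implicit Defensive.

Import Order.TTheory GRing.Theory Num.Theory.
Local Open Scope classical_set_scope.
Local Open Scope ring_scope.

Definition is_lie_bracket (K : fieldType) (g : vectType K) (br : g -> g -> g)
  : Prop :=
  [/\ forall x, linear (br x),
      forall y, linear (fun x => br x y),
      forall x, br x x = 0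
    & forall x y z, br x (br y z) + br y (br z x) + br z (br x y) = 0].

Definition is_simple_lie (K : fieldType) (g : vectType K) (br : g -> g -> g)
  : Prop :=
  [/\ is_lie_bracket br,
      exists x y, br x y != 0
    & forall I : {vspace g}, (forall x y, y \in I -> br x y \in I) ->
        I = 0%VS \/ I = fullv].

(* The index 0 of 'I_r.+1 is the affine node; the simple roots
   alpha_1, ..., alpha_r of g are indexed by 'I_r through [fnode]. *)
Definition fnode r (i : 'I_r) : 'I_r.+1 := lift ord0 i.

Record affine_datum (r : nat) := AffineDatum {
  acm : 'M[int]_r.+1;       (* the Cartan matrix (a_ij) *)
  adg : 'I_r.+1 -> nat;     (* the symmetrizing integers d_i *)
  amk : 'I_r.+1 -> nat      (* the marks n_i: delta = \sum_i n_i alpha_i *)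
}.

Definition form r (D : affine_datum r) (i j : 'I_r.+1) : int :=
  (adg D i)%:Z * acm D i j.

(* [e], [f], [h] are Chevalley generators of g, with Cartan matrix the
   restriction of (a_ij) to the finite nodes. *)
Definition is_chevalley (K : fieldType) (g : vectType K) (br : g -> g -> g)
    r (D : affine_datum r) (e f h : 'I_r -> g) : Prop :=
  let a i j := acm D (fnode i) (fnode j) in
  [/\ free [seq h i | i <- enum 'I_r],
      (forall i, a i i = 2) /\ (forall i j, br (h i) (h j) = 0),
      forall i j, br (h i) (e j) = (a i j)%:~R *: e j /\
                  br (h i) (f j) = - (a i j)%:~R *: f j,
      forall i j, br (e i) (f j) = if i == j then h i else 0
    & forall U : {vspace g},
        (forall i, e i \in U /\ f i \in U) ->
        (forall x y, x \in U -> y \in U -> br x y \in U) -> U = fullv].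

(* [x] is a root vector for the root \sum_j beta_j alpha_j *)
Definition is_root_vector (K : fieldType) (g : vectType K) (br : g -> g -> g)
    r (D : affine_datum r) (h : 'I_r -> g) (beta : 'I_r -> int) (x : g)
  : Prop :=
  [/\ x != 0, exists j, beta j != 0
    & forall i, br (h i) x =
        (\sum_j acm D (fnode i) (fnode j) * beta j)%:~R *: x].

Definition is_root (K : fieldType) (g : vectType K) (br : g -> g -> g)
    r (D : affine_datum r) (h : 'I_r -> g) (beta : 'I_r -> int) : Prop :=
  exists x, is_root_vector br D h beta x.

Definition is_highest_root (K : fieldType) (g : vectType K) (br : g -> g -> g)
    r (D : affine_datum r) (h : 'I_r -> g) (theta : 'I_r -> int) : Prop :=
  is_root br D h theta /\
  forall beta, is_root br D h beta -> forall i, beta i <= theta i.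

Definition theta r (D : affine_datum r) (i : 'I_r) : int :=
  (amk D (fnode i))%:Z.

(* alpha_0 = delta - theta, and delta pairs to zero with every coroot; together
   with symmetrizability this determines the row and column 0 of (a_ij). *)
Definition is_untwisted_affine (K : fieldType) (g : vectType K)
    (br : g -> g -> g) r (D : affine_datum r) (h : 'I_r -> g) : Prop :=
  [/\ (forall i, (1 <= adg D i <= 3)%N) /\ \big[gcdn/0%N]_i adg D i = 1%N,
      forall i j, form D i j = form D j i,
      acm D ord0 ord0 = 2 /\ amk D ord0 = 1%N,
      is_highest_root br D h (theta D)
    & forall i, \sum_j acm D i j * (amk D j)%:Z = 0].

Definition nested (K : fieldType) (g : vectType K) (br : g -> g -> g)
    r (e : 'I_r -> g) (s : seq 'I_r) (j : 'I_r) : g :=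
  foldr (fun i x => br (e i) x) (e j) s.

Definition not_root_of_unity (K : fieldType) (q : K) : Prop :=
  forall n, (0 < n)%N -> q ^+ n != 1.

Definition qnum (K : fieldType) (q : K) (n : nat) : K :=
  (q ^+ n - q ^- n) / (q - q^-1).
Definition qfact (K : fieldType) (q : K) (n : nat) : K :=
  \prod_(i < n) qnum q i.+1.
Definition qbinom (K : fieldType) (q : K) (n p : nat) : K :=
  qfact q n / (qfact q p * qfact q (n - p)).

(* [x] presents [A] by generators indexed by [X] and the relations [rel]. *)
Definition is_presented (K : fieldType) (A : algType K) (X : Type) (x : X -> A)
    (rel : forall B : algType K, (X -> B) -> Prop) : Prop :=
  rel A x /\
  forall (B : algType K) (y : X -> B), rel B y ->
    (exists phi : {lrmorphism A -> B}, forall g, phi (x g) = y g) /\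
    (forall phi psi : {lrmorphism A -> B},
       (forall g, phi (x g) = y g) -> (forall g, psi (x g) = y g) ->
       phi =1 psi).

Inductive dj_gen (r : nat) :=
  | DJe of 'I_r.+1     (* e_{alpha_i} *)
  | DJf of 'I_r.+1     (* e_{-alpha_i} *)
  | DJk of 'I_r.+1     (* k_{alpha_i} *)
  | DJkV of 'I_r.+1    (* k_{alpha_i}^-1 *)
  | DJd                (* q^d *)
  | DJdV               (* q^-d *)
  | DJc                (* k_delta^(1/2) *)
  | DJcV.              (* k_delta^(-1/2) *)
Arguments DJd {r}.
Arguments DJdV {r}.
Arguments DJc {r}.
Arguments DJcV {r}.

Section DrinfeldJimbo.
Context (K : fieldType) (q : K) (r : nat) (D : affine_datum r).

Definition qd (i : 'I_r.+1) : K := q ^+ adg D i.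

Definition serre_len (i j : 'I_r.+1) : nat := `|1 - acm D i j|%N.

Definition dj_serre (B : algType K) (i j : 'I_r.+1) (x y : B) : B :=
  \sum_(p < (serre_len i j).+1) (-1) ^+ p *:
    (((qfact (qd i) p)^-1 *: x ^+ p) * y *
     ((qfact (qd i) (serre_len i j - p))^-1 *: x ^+ (serre_len i j - p))).

Record dj_rel (B : algType K) (x : dj_gen r -> B) : Prop := DJRel {
  dj_kV : forall i, x (DJk i) * x (DJkV i) = 1 /\ x (DJkV i) * x (DJk i) = 1;
  dj_dV : x DJd * x DJdV = 1 /\ x DJdV * x DJd = 1;
  dj_cV : x DJc * x DJcV = 1 /\ x DJcV * x DJc = 1;
  dj_c : forall g, GRing.comm (x DJc) (x g);
  dj_cc : x DJc ^+ 2 = \prod_(i < r.+1) x (DJk i) ^+ amk D i;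
  dj_kk : forall i j, GRing.comm (x (DJk i)) (x (DJk j));
  dj_kd : forall i, GRing.comm (x (DJk i)) (x DJd);
  dj_de : forall i, x DJd * x (DJe i) * x DJdV =
    q ^+ (i == ord0) *: x (DJe i);
  dj_df : forall i, x DJd * x (DJf i) * x DJdV =
    q ^- (i == ord0) *: x (DJf i);
  dj_ke : forall i j, x (DJk i) * x (DJe j) * x (DJkV i) =
    qd i ^ acm D i j *: x (DJe j);
  dj_kf : forall i j, x (DJk i) * x (DJf j) * x (DJkV i) =
    qd i ^ (- acm D i j) *: x (DJf j);
  dj_ef : forall i j, x (DJe i) * x (DJf j) - x (DJf j) * x (DJe i) =
    if i == j then (qd i - (qd i)^-1)^-1 *: (x (DJk i) - x (DJkV i)) else 0;
  dj_serre_e : forall i j, i != j -> dj_serre i j (x (DJe i)) (x (DJe j)) = 0;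
  dj_serre_f : forall i j, i != j -> dj_serre i j (x (DJf i)) (x (DJf j)) = 0
}.

End DrinfeldJimbo.

(* [Curh i 0] is a placeholder: it is set to zero by [cur_rel]. *)
Inductive cur_gen (r : nat) :=
  | CurC
  | CurCV
  | Curd               (* q^d *)
  | CurdV
  | Cure of 'I_r & int
  | Curf of 'I_r & int
  | Curk of 'I_r
  | CurkV of 'I_r
  | Curh of 'I_r & int.
Arguments CurC {r}.
Arguments CurCV {r}.
Arguments Curd {r}.
Arguments CurdV {r}.

(* One-variable power series, as sequences of coefficients. *)
Definition ps_mul (B : nzRingType) (F G : nat -> B) (n : nat) : B :=
  \sum_(i < n.+1) F i * G (n - i)%N.
Definition ps_one (B : nzRingType) (n : nat) : B := (n == 0%N)%:R.
Definition ps_pow (B : nzRingType) (F : nat -> B) (k : nat) : nat -> B :=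
  iter k (ps_mul F) (ps_one B).
(* The exponential of a series [F] without constant term: [F ^ k] has no
   coefficient of degree < k, so the sum stops at k = n. *)
Definition ps_exp (K : fieldType) (B : algType K) (F : nat -> B) (n : nat) : B :=
  \sum_(k < n.+1) (k`!)%:R^-1 *: ps_pow F k n.

(* Two-sided series F(z,w) = \sum_(m,n) F m n z^-m w^-n;
   [dlin x y F] is (x z - y w) F(z,w). *)
Definition dlin (B : nzRingType) (x y : B) (F : int -> int -> B) (m n : int)
  : B := x * F (m + 1) n - y * F m (n + 1).

Section Currents.
Context (K : fieldType) (q : K) (r : nat) (D : affine_datum r).

Definition fform (i j : 'I_r) : int := form D (fnode i) (fnode j).

Definition qf (i : 'I_r) : K := qd q D (fnode i).

Section Elements.
Context (B : algType K) (y : cur_gen r -> B).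

(* The power C^n, for a possibly negative n. *)
Definition Cpow (n : int) : B :=
  match n with Posz n => y CurC ^+ n | Negz n => y CurCV ^+ n.+1 end.

(* psi^+_alpha[n] and psi^-_alpha[n], for n : int *)
Definition psip (i : 'I_r) (n : int) : B :=
  if 0 <= n then y (Curk i) *
    ps_exp (fun l => if l == 0%N then 0
                     else (qf i - (qf i)^-1) *: y (Curh i l%:Z)) `|n|%N
  else 0.
Definition psim (i : 'I_r) (n : int) : B :=
  if n <= 0 then y (CurkV i) *
    ps_exp (fun l => if l == 0%N then 0
                     else - (qf i - (qf i)^-1) *: y (Curh i (- l%:Z))) `|n|%N
  else 0.

(* The coefficient of z_1^-a_1 ... z_m^-a_m w^-b in
   \sum_p (-1)^p binom(m,p) Sym x_i(z_1)...x_i(z_p) x_j(w) x_i(z_p+1)... *)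
Definition cur_serre (i : 'I_r) (m : nat) (xi : int -> B) (xj : int -> B)
    (a : 'I_m -> int) (b : int) : B :=
  \sum_(p < m.+1) ((-1) ^+ p * qbinom (qf i) m p) *:
    \sum_(s : 'S_m)
      let l := [seq xi (a (s k)) | k <- enum 'I_m] in
      \prod_(x <- take p l ++ xj b :: drop p l) x.

(* The relations involving psi^+ and psi^- have their denominators cleared;
   psi^+(z) is a series in z^-1 and psi^-(z) a series in z, and each fraction
   is expanded in the corresponding region. *)
Record cur_rel : Prop := CurRel {
  cur_h0 : forall i, y (Curh i 0) = 0;
  cur_CV : y CurC * y CurCV = 1 /\ y CurCV * y CurC = 1;
  cur_dV : y Curd * y CurdV = 1 /\ y CurdV * y Curd = 1;
  cur_kV : forall i, y (Curk i) * y (CurkV i) = 1 /\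
                     y (CurkV i) * y (Curk i) = 1;
  cur_C : forall g, GRing.comm (y CurC) (y g);
  cur_de : forall i n, y Curd * y (Cure i n) * y CurdV = q ^ n *: y (Cure i n);
  cur_df : forall i n, y Curd * y (Curf i n) * y CurdV = q ^ n *: y (Curf i n);
  cur_dpsip : forall i n, y Curd * psip i n * y CurdV = q ^ n *: psip i n;
  cur_dpsim : forall i n, y Curd * psim i n * y CurdV = q ^ n *: psim i n;
  cur_ee : forall i j, let Q : B := (q ^ fform i j)%:A in
    dlin 1 Q (fun m n => y (Cure i m) * y (Cure j n)) =2
    dlin Q 1 (fun m n => y (Cure j n) * y (Cure i m));
  cur_ff : forall i j, let Q : B := (q ^ (- fform i j))%:A in
    dlin 1 Q (fun m n => y (Curf i m) * y (Curf j n)) =2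
    dlin Q 1 (fun m n => y (Curf j n) * y (Curf i m));
  cur_psipe : forall i j, let Q : B := (q ^ fform i j)%:A in
    dlin (y CurC) Q (fun m n => psip i m * y (Cure j n)) =2
    dlin (Q * y CurC) 1 (fun m n => y (Cure j n) * psip i m);
  cur_psime : forall i j, let Q : B := (q ^ fform i j)%:A in
    dlin (y CurCV) Q (fun m n => psim i m * y (Cure j n)) =2
    dlin (Q * y CurCV) 1 (fun m n => y (Cure j n) * psim i m);
  cur_psipf : forall i j, let Q : B := (q ^ (- fform i j))%:A in
    dlin (y CurCV) Q (fun m n => psip i m * y (Curf j n)) =2
    dlin (Q * y CurCV) 1 (fun m n => y (Curf j n) * psip i m);
  cur_psimf : forall i j, let Q : B := (q ^ (- fform i j))%:A in
    dlin (y CurC) Q (fun m n => psim i m * y (Curf j n)) =2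
    dlin (Q * y CurC) 1 (fun m n => y (Curf j n) * psim i m);
  cur_psipp : forall i j m n, GRing.comm (psip i m) (psip j n);
  cur_psimm : forall i j m n, GRing.comm (psim i m) (psim j n);
  cur_psipm : forall i j, let Q : B := (q ^ fform i j)%:A in
    let C2 : B := y CurC ^+ 2 in
    dlin Q C2 (dlin C2 Q (fun m n => psip i m * psim j n)) =2
    dlin 1 (Q * C2) (dlin (Q * C2) 1 (fun m n => psim j n * psip i m));
  (* delta(z / C^2 w) psi^+(C^-1 z) has coefficient C^(-2n) C^(m+n) psi^+[m+n]
     at z^-m w^-n, and delta(C^2 z / w) psi^-(C^-1 w) has coefficient
     C^(-2m) C^(m+n) psi^-[m+n]. *)
  cur_ef : forall i j m n,
    y (Cure i m) * y (Curf j n) - y (Curf j n) * y (Cure i m) =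
    if i == j then (qf i - (qf i)^-1)^-1 *:
      (Cpow (- (2 * n)) * Cpow (m + n) * psip i (m + n) -
       Cpow (- (2 * m)) * Cpow (m + n) * psim i (m + n))
    else 0;
  cur_serre_e : forall i j, i != j ->
    forall (a : 'I_(serre_len D (fnode i) (fnode j)) -> int) (b : int),
    cur_serre i (fun n => y (Cure i n)) (fun n => y (Cure j n)) a b = 0;
  cur_serre_f : forall i j, i != j ->
    forall (a : 'I_(serre_len D (fnode i) (fnode j)) -> int) (b : int),
    cur_serre i (fun n => y (Curf i n)) (fun n => y (Curf j n)) a b = 0
}.

Definition Splus (i : 'I_r) (x : B) : B :=
  y (Cure i 0) * x - y (Curk i) * x * y (CurkV i) * y (Cure i 0).
Definition Sminus (i : 'I_r) (x : B) : B :=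
  x * y (Curf i 0) - y (Curf i 0) * y (Curk i) * x * y (CurkV i).

End Elements.

(* The two families of generators [x] and [y] of [A] are matched as in the
   isomorphism between the two presentations; [s] and [j] are such that
   [e_(s_1), [..., [e_(s_n), e_j] ...]] is a nonzero multiple of a root vector
   of the highest root. *)
Definition identified (g : vectType K) (br : g -> g -> g) (e h : 'I_r -> g)
    (A : algType K) (x : dj_gen r -> A) (y : cur_gen r -> A) : Prop :=
  [/\ forall i, [/\ x (DJk (fnode i)) = y (Curk i),
                    x (DJe (fnode i)) = y (Cure i 0)
                  & x (DJf (fnode i)) = y (Curf i 0)],
      x DJc = y CurC,
      x DJd = y Curd,
      x (DJk ord0) =
        y CurC ^+ 2 * \prod_(i < r) y (CurkV i) ^+ amk D (fnode i)
    & exists (s : seq 'I_r) (j : 'I_r) (etheta : g) (c lambda mu : K),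
      [/\ is_root_vector br D h (theta D) etheta,
          c != 0 /\ nested br e s j = c *: etheta,
          lambda != 0 /\ mu != 0,
          x (DJe ord0) =
            mu *: (foldr (Sminus y) (y (Curf j 1)) s * x (DJk ord0))
        & x (DJf ord0) =
            lambda *: (x (DJkV ord0) * foldr (Splus y) (y (Cure j (-1))) s)]].

End Currents.

Inductive gen_subalg (K : fieldType) (A : algType K) (S : set A) : set A :=
  | GenIn x : S x -> gen_subalg S x
  | Gen1 : gen_subalg S 1
  | GenD x y : gen_subalg S x -> gen_subalg S y -> gen_subalg S (x + y)
  | GenM x y : gen_subalg S x -> gen_subalg S y -> gen_subalg S (x * y)
  | GenZ c x : gen_subalg S x -> gen_subalg S (c *: x).

(* \sum_(e in E) S e *)
Inductive left_span (K : fieldType) (A : algType K) (S E : set A) : set A :=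
  | LSpan0 : left_span S E 0
  | LSpanD x y : left_span S E x -> left_span S E y -> left_span S E (x + y)
  | LSpanM b e : S b -> E e -> left_span S E (b * e).

Section Subalgebras.
Context (K : fieldType) (r : nat) (A : algType K).
Context (x : dj_gen r -> A) (y : cur_gen r -> A).

Definition gensH : set A :=
  x @` [set g | match g with DJe _ | DJf _ => False | _ => True end].
Definition Un_plus : set A := gen_subalg [set x (DJe i) | i in setT].
Definition Un_minus : set A := gen_subalg [set x (DJf i) | i in setT].
Definition Ub_plus : set A := gen_subalg (Un_plus `|` gensH).
Definition UF : set A :=
  gen_subalg (gensH `|` [set z | exists i n, z = y (Curf i n)]
                    `|` [set z | exists i n, 0 < n /\ z = y (Curh i n)]).
Definition Uf_minus : set A := UF `&` Un_minus.
Definition UF_plus : set A := UF `&` Ub_plus.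
Definition Jideal : set A :=
  left_span Ub_plus [set z | exists i n, 0 <= n /\ z = y (Cure i n)].

Definition is_counit (eps : {lrmorphism A -> K^o}) : Prop :=
  [/\ forall i, eps (x (DJe i)) = 0 /\ eps (x (DJf i)) = 0,
      forall i, eps (x (DJk i)) = 1,
      eps (x DJc) = 1
    & eps (x DJd) = 1].

(* As a map on [A], [P] is only meaningful on U_F, where it is determined by
   these conditions since U_F is spanned by the products f_- f_+. *)
Definition is_projection (eps : {lrmorphism A -> K^o}) (P : A -> A) : Prop :=
  [/\ forall z, UF z -> UF_plus (P z),
      forall c z z', UF z -> UF z' -> P (c *: z + z') = c *: P z + P z'
    & forall fm fp, Uf_minus fm -> UF_plus fp ->
        P (fm * fp) = (eps fm : K) *: fp].

End Subalgebras.

(* [pi] restricts to a linear surjection V -> M with kernel W, so that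
   M = V / W; its values outside V are irrelevant. *)
Definition is_quotient (K : fieldType) (A : algType K) (V W : set A)
    (M : lmodType K) (pi : A -> M) : Prop :=
  [/\ forall c z z', V z -> V z' -> pi (c *: z + z') = c *: pi z + pi z',
      forall m, exists2 z, V z & pi z = m
    & forall z, V z -> (pi z = 0 <-> W z)].

(* A series in (t_i) is recorded through its coefficients in the variables
   u_i = t_i^-1: [F a] is the coefficient of \prod_i u_i^(a_i). *)
Definition lseries (n : nat) (M : Type) := {ffun 'I_n -> int} -> M.

Section LaurentSeries.
Context (K : fieldType) (n : nat) (M : lmodType K).

Definition uexp (i : 'I_n) : {ffun 'I_n -> int} := [ffun j => (j == i)%:R].

Definition umul (i : 'I_n) (F : lseries n M) : lseries n M :=
  fun a => F (a - uexp i).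

Definition umulB (c : K) (i j : 'I_n) (F : lseries n M) : lseries n M :=
  fun a => umul i F a - c *: umul j F a.

(* Division by u_i - c u_j for i < j, in the space of iterated Laurent series
   M((u_n)) ... ((u_1)), where
   1 / (u_i - c u_j) = - \sum_(k >= 0) c^-(k+1) u_i^k u_j^-(k+1);
   the sum below has finite support when F belongs to that space. *)
Definition udivB (c : K) (i j : 'I_n) (F : lseries n M) : lseries n M :=
  fun a => - \sum_(k \in [set: nat])
    c ^- k.+1 *: F (a - uexp i *+ k + uexp j *+ k.+1).

End LaurentSeries.

(* An ordered Pi-multiset is a word c : 'I_n -> 'I_r, since a finite totally
   ordered set is uniquely isomorphic to some 'I_n. *)
Section Words.
Context (r n : nat) (c : 'I_n -> 'I_r).

(* |I_s| *)
Definition wcount (s : 'I_r) : nat := #|[pred i | c i == s]|.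

(* (s, j) is sent to the j-th element of I_s, in increasing order. *)
Definition wpos (v : {s : 'I_r & 'I_(wcount s)}) : 'I_n :=
  enum_val (tagged v).

Definition shuffle_seq : seq 'I_n :=
  flatten [seq enum [pred i | c i == s] | s <- enum 'I_r].

Lemma perm_shuffle_seq : perm_eq shuffle_seq (enum 'I_n).
Proof.
apply: uniq_perm; last 1 first.
- move=> i; rewrite mem_enum inE; apply/flattenP.
  exists (enum [pred j | c j == c i]); last by rewrite mem_enum inE.
  by apply/mapP; exists (c i); rewrite ?mem_enum.
- rewrite /shuffle_seq.
  have : uniq (enum 'I_r) by exact: enum_uniq.
  elim: (enum 'I_r) => //= s l IHl /andP[sl ul].
  rewrite cat_uniq enum_uniq IHl // andbT; apply/hasPn => i /flattenP[m /mapP[t tl ->]].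
  rewrite !mem_enum !inE => /eqP ->.
  by apply: contraNN sl => /eqP <-.
- exact: enum_uniq.
Qed.

Lemma size_shuffle_seq : size shuffle_seq = n.
Proof. by rewrite (perm_size perm_shuffle_seq) size_enum_ord. Qed.

Definition shuffle_fun (k : 'I_n) : 'I_n :=
  tnth (in_tuple shuffle_seq) (cast_ord (esym size_shuffle_seq) k).

Lemma shuffle_fun_inj : injective shuffle_fun.
Proof.
have u : uniq shuffle_seq by rewrite (perm_uniq perm_shuffle_seq) enum_uniq.
move=> k l; rewrite /shuffle_fun !(tnth_nth k) /= => /eqP.
by rewrite nth_uniq ?size_shuffle_seq // => /eqP /val_inj.
Qed.

(* The permutation sigma of the formula defining Wbar. *)
Definition shuffle : 'S_n := perm shuffle_fun_inj.

End Words.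

(* Formal power series with coefficients in M in the variables u_j^(s),
   1 <= s <= r, 1 <= j <= nu s. *)
Definition uvar (r : nat) (nu : 'I_r -> nat) := {s : 'I_r & 'I_(nu s)}.
Definition pseries (r : nat) (nu : 'I_r -> nat) (M : Type) :=
  {ffun uvar nu -> nat} -> M.

Definition uvarE r (nu : 'I_r -> nat) (s : 'I_r) (j : 'I_(nu s)) : uvar nu :=
  Tagged (fun s => 'I_(nu s)) j.

Definition group_symmetric r (nu : 'I_r -> nat) (M : Type) (W : pseries nu M)
  : Prop :=
  forall (sigma : forall s, 'S_(nu s)) (a : {ffun uvar nu -> nat}),
    W [ffun v : uvar nu => a (uvarE (sigma (tag v) (tagged v)))] = W a.

Section WeightFunctions.
Context (K : fieldType) (q : K) (r : nat) (D : affine_datum r).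
Context (M : lmodType K).

(* Substitution of (u_i)_(i in I_s) for (u_j^(s))_j *)
Definition wsubst n (c : 'I_n -> 'I_r) (W : pseries (wcount c) M)
  : lseries n M :=
  fun a => if [forall i, 0 <= a i]
           then W [ffun v : uvar (wcount c) => `|a (wpos v)|%N] else 0.

Definition wpairs n : seq ('I_n * 'I_n) :=
  [seq p : 'I_n * 'I_n <- enum {: 'I_n * 'I_n} | (p.1 < p.2)%N].

Definition weight_rhs n (c : 'I_n -> 'I_r) (W : pseries (wcount c) M)
  : lseries n M :=
  let F := foldr (fun p => udivB (q ^ fform D (c p.1) (c p.2)) p.1 p.2)
                 (wsubst W) (wpairs n) in
  let G := foldr (fun i => umul i) F (enum 'I_n) in
  let H := foldr (fun p => umulB 1 p.1 p.2) G
                 [seq p <- wpairs n | c p.1 == c p.2] in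
  fun a => (-1) ^+ shuffle c *: H a.

Context (A : algType K) (y : cur_gen r -> A) (P : A -> A) (pi : A -> M).

(* W_I(t) = P(f_(c 1)(t_1) ... f_(c n)(t_n)), modulo J *)
Definition weight_function n (c : 'I_n -> 'I_r) : lseries n M :=
  fun a => pi (P (\prod_(i < n) y (Curf (c i) (a i)))).

Definition is_Wbar (Wbar : forall nu : 'I_r -> nat, pseries nu M) : Prop :=
  (forall nu, group_symmetric (Wbar nu)) /\
  forall n (c : 'I_n -> 'I_r),
    weight_function c =1 weight_rhs (Wbar (wcount c)).

End WeightFunctions.

(* The value at u of the homogeneous component of degree d of W. *)
Definition homog_eval (K : fieldType) (M : lmodType K) r (nu : 'I_r -> nat)
    (W : pseries nu M) (d : nat) (u : uvar nu -> K) : M :=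
  \sum_(a : {ffun uvar nu -> 'I_d.+1} | (\sum_v a v)%N == d)
    (\prod_v u v ^+ a v) *: W [ffun v => a v : nat].

(* The restriction to a linear subspace H of a formal power series vanishes iff
   each of its homogeneous components, a polynomial function, vanishes on H. *)
Definition restriction_zero (K : fieldType) (M : lmodType K) r
    (nu : 'I_r -> nat) (W : pseries nu M) (H : set (uvar nu -> K)) : Prop :=
  forall d u, H u -> homog_eval W d u = 0.

(* H^{st}_{(k_1, ..., k_m), l}, with m = serre_len *)
Definition Hsub (K : fieldType) (q : K) r (D : affine_datum r)
    (nu : 'I_r -> nat) (s t : 'I_r)
    (k : 'I_(serre_len D (fnode s) (fnode t)) -> 'I_(nu s)) (l : 'I_(nu t))
  : set (uvar nu -> K) :=
  [set u | forall i : 'I_(serre_len D (fnode s) (fnode t)),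
     u (uvarE l) =
     q ^ (((2 * i%:Z - ((serre_len D (fnode s) (fnode t))%:Z - 1)) *
           fform D s s) %/ 2)%Z * u (uvarE (k i))].

(* Main.v *)
Require Import Defs.
From HB Require Import structures.
From mathcomp Require Import all_boot all_order all_algebra all_fingroup.
From mathcomp Require Import boolp classical_sets fsbigop reals.
From mathcomp Require Import complex.
From mathcomp Require Import zify ring.

(** Why the restriction vanishes.

    In the variables [u_i = t_i^-1] the weight function of a word is an
    iterated Laurent series [X]. Multiplied by all the forms
    [u_i - q^(alpha_i, alpha_j) u_j], [i] before [j], it becomes the power
    series Wbar times a product of linear forms; conversely [X] is obtained by
    expanding each inverse form in the region where [u_i] is much smaller than
    [u_j].

    Take a word which starts with one letter [t] (variable [w]) and
    [m = 1 - a_st] letters [s] (variables [z_1, ..., z_m]), followed by any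
    other letters. Permuting the [z]'s and moving [w] through them gives
    [(m + 1) m!] words, and the Serre relation for [f_s] and [f_t], multiplied
    on the right by the other currents, is a linear relation between their
    weight series, all read in the same variables. Clearing every denominator
    at once destroys its content, because the corresponding identity of
    rational functions carries no information on Wbar: what matters is that
    the terms are expanded in different regions. So only the denominators off
    the path [w, z_1, ..., z_m] are cleared, and one looks at the coefficients
    in which all the exponents of [z_1, ..., z_m] are very negative.

    - A word that does not start with [w] starts with some [z_i], whose
      exponent is bounded below: it does not contribute.
    - If [w] is first but [z_(j+1)] comes before [z_j], no denominator is left
      between [z_(j+1), ..., z_m] and the other variables, so the total degree
      in [z_(j+1), ..., z_m] is bounded below ([supp_ge_cut]): no contribution
      either.

    Hence the remaining term has no such coefficients ([serre_vanish]). This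
    term is [N / prod E_j], where [E_1, ..., E_m] are the forms of consecutive
    variables of the path and [N] is Wbar times linear forms. In the partial
    sums of the exponents, and after rescaling the variables by a point of the
    wheel [E_1 = ... = E_m = 0], each [E_j] becomes a difference operator; the
    sum of the coefficients of [N] telescopes to a single far coefficient of
    [N / prod E_j] ([box_sum_edges]), and that one is zero. So [N] vanishes on
    the wheel ([wheel_residue]). None of the linear forms in [N] vanishes
    identically there, so they can be cancelled ([cancel_forms]), and Wbar
    vanishes on the wheel ([word_vanish]).

    The subspace of the theorem is this wheel for the given [k_1, ..., k_m]
    and [l], put at the beginning of a word; the symmetry of Wbar makes the
    choice of the word irrelevant ([homog_eval_word]). That [m] equals
    [1 - a_st], without absolute value, is the nonpositivity of the
    off-diagonal Cartan integers ([cartan_le0]). *)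

Set Implicit Arguments.
Unset Strict Implicit.
Unset Printing Implicit Defensive.

Import Order.TTheory GRing.Theory Num.Theory.
Local Open Scope ring_scope.

(** * Laurent series and multiplication by linear forms *)

Section Degree.
Context (n : nat).
Implicit Types (a b : {ffun 'I_n -> int}) (T : pred 'I_n).

Definition deg T a : int := \sum_(i | T i) a i.

Lemma degD T a b : deg T (a + b) = deg T a + deg T b.
Proof. by rewrite /deg -big_split; apply: eq_bigr => i _; rewrite ffunE. Qed.

Lemma degN T a : deg T (- a) = - deg T a.
Proof. by rewrite /deg -sumrN; apply: eq_bigr => i _; rewrite ffunE. Qed.

Lemma degMn T a k : deg T (a *+ k) = deg T a *+ k.
Proof.
elim: k => [|k IH]; first by rewrite /deg big1 // => i _; rewrite ffunE.
by rewrite !mulrS degD IH.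
Qed.

Lemma deg_uexp T i : deg T (uexp i) = (T i)%:Z.
Proof.
rewrite /deg big_mkcond (bigD1 i) //= big1 ?addr0; last first.
  by move=> j ji; rewrite ffunE (negPf ji) if_same.
by rewrite ffunE eqxx; case: (T i).
Qed.

Lemma degMu T i k : deg T (uexp i *+ k) = (k * T i)%:Z.
Proof. by rewrite degMn deg_uexp pmulrn mulrzz mulrC. Qed.

Definition degE := (degD, degN, degMu, deg_uexp).

Lemma deg_ge0 T a : (forall i, 0 <= a i) -> 0 <= deg T a.
Proof. by move=> a0; rewrite /deg sumr_ge0. Qed.

End Degree.

Section Series.
Context (K : fieldType) (M : lmodType K) (n : nat).
Implicit Types (F G : lseries n M) (a b : {ffun 'I_n -> int}) (T : pred 'I_n).
Implicit Types (l : seq (K * ('I_n * 'I_n))).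

Definition supp_ge T (B : nat) F : Prop :=
  forall a, deg T a < - B%:Z -> F a = 0.

(** The entry [(c, (i, j))] of the list stands for the linear form
    [u_i - c u_j]; the single variable [u_i] is the entry [(0, (i, i))]. *)
Definition mulforms l F : lseries n M :=
  foldr (fun f => umulB f.1 f.2.1 f.2.2) F l.

Lemma mulforms_cat l l' F : mulforms (l ++ l') F = mulforms l (mulforms l' F).
Proof. by rewrite /mulforms foldr_cat. Qed.

Lemma umulBC c i j c' i' j' F :
  umulB c i j (umulB c' i' j' F) = umulB c' i' j' (umulB c i j F).
Proof.
apply/funext => a; rewrite /umulB /umul !scalerBr !scalerA (mulrC c').
rewrite (addrAC a (- uexp i') (- uexp i)) (addrAC a (- uexp j') (- uexp i)).
rewrite (addrAC a (- uexp i') (- uexp j)) (addrAC a (- uexp j') (- uexp j)).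
rewrite !opprB !addrA -!addrA; congr (_ + _).
by rewrite [RHS]addrC -addrA [RHS]addrCA [_ - c *: _]addrC addrA.
Qed.

Lemma mulforms_umulB l c i j F : mulforms l (umulB c i j F) = umulB c i j (mulforms l F).
Proof. by elim: l => //= f l ->; rewrite umulBC. Qed.

Lemma mulformsC l l' F : mulforms l (mulforms l' F) = mulforms l' (mulforms l F).
Proof. by elim: l => //= f l ->; rewrite mulforms_umulB. Qed.

Lemma mulforms_perm l l' F : perm_eq l l' -> mulforms l F = mulforms l' F.
Proof.
move=> pl; move: {1 3}l l' pl (erefl (mulforms l F)).
apply: (@catCA_perm_ind _ (fun l2 => mulforms l F = mulforms l2 F)) => s1 s2 s3.
by rewrite !mulforms_cat (mulformsC s1).
Qed.

Lemma umulE i F : umul i F = umulB 0 i i F.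
Proof. by apply/funext => a; rewrite /umulB scale0r subr0. Qed.

Lemma mulformsZ l x F : mulforms l (fun a => x *: F a) = (fun a => x *: mulforms l F a).
Proof.
elim: l => //= f l ->; apply/funext => a.
by rewrite /umulB /umul scalerBr !scalerA mulrC.
Qed.

Lemma mulforms_sum (I : finType) (Q : pred I) l (F : I -> lseries n M) :
  mulforms l (fun a => \sum_(x | Q x) F x a) =
  (fun a => \sum_(x | Q x) mulforms l (F x) a).
Proof.
elim: l => //= f l ->; apply/funext => a.
by rewrite /umulB /umul scaler_sumr -sumrB.
Qed.

Lemma supp_ge_umulB T B c i j F : supp_ge T B F -> supp_ge T B (umulB c i j F).
Proof.
move=> FB a aB; rewrite /umulB /umul !FB ?scaler0 ?subr0 // !degE.
  by case: (T j) => /=; lia.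
by case: (T i) => /=; lia.
Qed.

Lemma supp_ge_mulforms T B l F : supp_ge T B F -> supp_ge T B (mulforms l F).
Proof. by move=> FB; elim: l => //= f l IH; apply: supp_ge_umulB. Qed.

Lemma supp_geW T B B' F : (B <= B')%N -> supp_ge T B F -> supp_ge T B' F.
Proof. by move=> BB FB a aB; apply: FB; lia. Qed.

Definition nonneg F : Prop := forall a, F a != 0 -> forall i, 0 <= a i.

Definition initial (rho : 'I_n -> nat) (k : nat) : pred 'I_n :=
  [pred i | (rho i < k)%N].

Lemma initialE rho k i : initial rho k i = (rho i < k)%N.
Proof. by []. Qed.

(** Expanding [1 / (u_i - c u_j)] for [i] before [j] moves degree from [u_j] to
    the earlier [u_i], so only the partial sums of the exponents in the order
    [rho] stay bounded below. This implies the support condition of iterated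
    Laurent series and is easier to handle. *)
Definition cone rho B F : Prop := forall k, supp_ge (initial rho k) B F.

Lemma cone_umulB rho B c i j F : cone rho B F -> cone rho B (umulB c i j F).
Proof. by move=> FB k; apply: supp_ge_umulB. Qed.

Lemma cone_mulforms rho B l F : cone rho B F -> cone rho B (mulforms l F).
Proof. by move=> FB k; apply: supp_ge_mulforms. Qed.

(** This is what makes the expansion of [1 / (u_i - c u_j)] a finite sum in
    each coefficient: the exponents leave the cone through the partial sum that
    ends at [i]. *)
Lemma cone_vanish rho B F i j a : cone rho B F -> (rho i < rho j)%N ->
  exists L, forall k, (L <= k)%N -> F (a - uexp i *+ k + uexp j *+ k.+1) = 0.
Proof.
move=> FB ij; exists (`|deg (initial rho (rho i).+1) a|%N + B.+1)%N => k Lk.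
apply: (FB (rho i).+1); rewrite !degE.
have -> : initial rho (rho i).+1 i by rewrite initialE ltnSn.
have -> : initial rho (rho i).+1 j = false by rewrite initialE ltnS leqNgt ij.
lia.
Qed.

(** A linear form inside [T] or outside [T] is homogeneous for the [T]-degree,
    so dividing by it lowers that degree by at most one. No quotient is
    constructed: in low degree [F (a) = c^-1 F (a - e_i + e_j)], and iterating
    leads out of the cone. *)
Lemma supp_ge_umulBK rho B T t c i j F : cone rho B F -> (rho i < rho j)%N ->
  c != 0 -> T i = T j -> supp_ge T t (umulB c i j F) -> supp_ge T t.+1 F.
Proof.
move=> FB ij c0 Tij Fb a ab.
have step : forall a, deg T a < - t.+1%:Z ->
    F a = c^-1 *: F (a - uexp i + uexp j).
  move=> x xb; have := Fb (x + uexp j).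
  rewrite /umulB /umul addrK (addrAC x) => E.
  have /eqP : F (x - uexp i + uexp j) - c *: F x = 0.
    by apply: E; rewrite !degE; case: (T j) => /=; lia.
  by rewrite subr_eq0 => /eqP ->; rewrite scalerA mulVf ?scale1r.
have E k : F a = c ^- k *: F (a - uexp i *+ k + uexp j *+ k).
  elim: k => [|k ->]; first by rewrite !mulr0n subr0 addr0 expr0 invr1 scale1r.
  rewrite step; last by rewrite !degE Tij; lia.
  rewrite scalerA exprSr invfM mulrC; congr (_ *: F _).
  by apply/ffunP => x; rewrite !(ffunE, ffunMnE) !mulrS; ring.
have [L FL] := cone_vanish (a - uexp j) FB ij.
have FLL := FL L (leqnn _); rewrite (E L).
suff -> : a - uexp i *+ L + uexp j *+ L = a - uexp j - uexp i *+ L + uexp j *+ L.+1.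
  by rewrite FLL scaler0.
by apply/ffunP => x; rewrite !(ffunE, ffunMnE) mulrS; ring.
Qed.

End Series.

(** * Division of iterated Laurent series *)

Section Division.
Context (K : fieldType) (M : lmodType K) (n : nat).
Context (rho : 'I_n -> nat) (B : nat) (c : K) (i j : 'I_n).
Hypothesis ij : (rho i < rho j)%N.
Implicit Types (F : lseries n M).

Lemma udivB_fin F a : cone rho B F ->
  exists L, forall N, (L <= N)%N -> udivB c i j F a =
    - \sum_(k < N) c ^- k.+1 *: F (a - uexp i *+ k + uexp j *+ k.+1).
Proof.
move=> FB; have [L FL] := cone_vanish a FB ij.
exists L => N LN; rewrite /udivB; congr (- _).
rewrite (fsbig_ord _ _ (fun k => c ^- k.+1 *: F (a - uexp i *+ k + uexp j *+ k.+1))).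
apply/esym/fsbig_widen => // k [_ /= kN].
by rewrite FL ?scaler0 // (leq_trans LN) // leqNgt; apply/negP.
Qed.

Lemma cone_udivB F : cone rho B F -> cone rho B.+1 (udivB c i j F).
Proof.
move=> FB k a ak; rewrite /udivB fsbig1 ?oppr0 // => l _.
rewrite (FB k) ?scaler0 // !degE !initialE.
by case: (ltnP (rho i) k); case: (ltnP (rho j) k) => /=; lia.
Qed.

Hypothesis c0 : c != 0.

Lemma udivBK F : cone rho B F -> umulB c i j (udivB c i j F) = F.
Proof.
move=> FB; apply/funext => a; rewrite /umulB /umul.
have [L1 E1] := udivB_fin (a - uexp i) FB.
have [L2 E2] := udivB_fin (a - uexp j) FB.
rewrite (E1 (maxn L1 L2)) ?leq_maxl // (E2 (maxn L1 L2).+1); last first.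
  by rewrite leqW ?leq_maxr.
rewrite scalerN opprK big_ord_recl /= scalerDr addrCA !mulr0n subr0 subrK.
rewrite scalerA expr1 mulfV // scale1r scaler_sumr -[RHS]addr0; congr (_ + _).
rewrite -sumrN -big_split big1 //= => k _.
rewrite scalerA; have -> : c * c ^- (bump 0 k).+1 = c ^- k.+1.
  by rewrite /bump add1n (exprS c k.+1) invfM mulrA mulfV // mul1r.
rewrite addrC; apply/eqP; rewrite subr_eq0; apply/eqP; congr (_ *: F _).
by apply/ffunP => v; rewrite !(ffunE, ffunMnE) /bump /= !mulrS; ring.
Qed.

End Division.

(** * Telescoping along a path of edges *)

Section Telescoping.
Context (K : fieldType) (M : lmodType K) (n : nat).
Implicit Types (F Z : lseries n.+1 M) (a : {ffun 'I_n.+1 -> int}).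

Notation ord := (@nat_of_ord n.+1).

(** Adding this vector to an exponent raises its partial sum of length [k + 1]
    by one and leaves all the other partial sums unchanged. In the coordinates
    given by the partial sums, multiplication by [u_k - u_(k+1)] is thus a
    difference operator in one coordinate, followed by a translation. *)
Definition edge_vec k : {ffun 'I_n.+1 -> int} := uexp (inord k) - uexp (inord k.+1).

Lemma deg_edge_vec k j : (k < n)%N -> deg (initial ord j) (edge_vec k) = (j == k.+1)%:Z.
Proof.
by move=> kn; rewrite /edge_vec !degE !initialE !inordK //; lia.
Qed.

Lemma deg_edge_vecMn k j l : (k < n)%N ->
  deg (initial ord j) (edge_vec k *+ l) = (l * (j == k.+1))%:Z.
Proof. by move=> kn; rewrite degMn deg_edge_vec // pmulrn mulrzz mulrC. Qed.

Lemma deg_initialS (j : 'I_n.+1) a :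
  deg (initial ord j.+1) a = deg (initial ord j) a + a j.
Proof.
rewrite /deg (bigD1 j) /=; last by rewrite !initialE ltnS.
rewrite addrC; congr (_ + _); apply: eq_bigl => i; rewrite !initialE.
by rewrite -val_eqE /=; lia.
Qed.

Lemma initial_inj a a' :
  (forall j, (j <= n.+1)%N -> deg (initial ord j) a = deg (initial ord j) a') ->
  a = a'.
Proof.
move=> E; apply/ffunP => j; apply: (@addrI _ (deg (initial ord j) a)).
by rewrite -deg_initialS [in RHS]E ?(ltnW (ltn_ord j)) // -deg_initialS E.
Qed.

Context (L : nat).

(** Sum of the coefficients over a box of side [L] in the first [k] partial
    sums, starting at [a]. *)
Fixpoint box_sum k F a : M :=
  if k is k'.+1 then \sum_(i < L) box_sum k' F (a + edge_vec k' *+ i) else F a.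

(** Position, relative to the start of the box, of the one corner that survives
    in [box_sum_edges]. *)
Fixpoint corner_vec k : {ffun 'I_n.+1 -> int} :=
  if k is k'.+1 then corner_vec k' + edge_vec k' *+ L.-1 - uexp (inord k) else 0.

Definition edges (kap : nat -> K) k : seq (K * ('I_n.+1 * 'I_n.+1)) :=
  [seq (kap j, (inord j, inord j.+1)) | j <- iota 0 k].

Lemma mulforms_edges_recr kap k F : mulforms (edges kap k.+1) F =
  mulforms (edges kap k) (umulB (kap k) (inord k) (inord k.+1) F).
Proof.
by rewrite /edges; have := iotaD 0 k 1; rewrite addn1 => ->; rewrite map_cat mulforms_cat.
Qed.

Lemma deg_corner_vec k j : (0 < L)%N -> (k <= n)%N -> deg (initial ord j) (corner_vec k) =
  if j == 0%N then 0 else if (j <= k)%N then L%:Z - j%:Z else - k%:Z.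
Proof.
move=> L0; elim: k => [|k IH] kn /=.
  rewrite /deg big1 ?if_same //; first by case: j => //= j; case: ltnP.
  by move=> i _; rewrite ffunE.
rewrite !degE deg_edge_vecMn // IH ?(ltnW kn) // !initialE inordK //.
have [->|j0] := eqVneq j 0%N; first by rewrite muln0 subr0 addr0.
have [jk|jk|->] := ltngtP j k.+1.
- have -> : (j <= k)%N by rewrite -ltnS.
  by rewrite muln0 addr0 subr0.
- have -> : (j <= k)%N = false by lia.
  by rewrite muln0 addr0; lia.
- rewrite ltnn muln1 subr0 /=; lia.
Qed.

(** The sum of an iterated difference over a box is an alternating sum over the
    corners. All the corners but one have some partial sum below the cone. *)
Lemma box_sum_edges B k Z a : (0 < L)%N -> (k <= n)%N -> cone ord B Z ->
  (forall j, (0 < j <= k)%N -> deg (initial ord j) a <= - B%:Z) ->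
  box_sum k (mulforms (edges (fun=> 1) k) Z) a = (-1) ^+ k *: Z (a + corner_vec k).
Proof.
move=> L0; elim: k Z a => [|k IH] Z a kn ZB aB.
  by rewrite /= addr0 expr0 scale1r.
rewrite mulforms_edges_recr /=.
pose g i := Z (a + corner_vec k + edge_vec k *+ i - edge_vec k - uexp (inord k.+1)).
transitivity (\sum_(i < L) (-1) ^+ k *: (g i - g i.+1)).
  apply: eq_bigr => i _; rewrite (IH _ _ (ltnW kn)); last 2 first.
  - exact: cone_umulB.
  - move=> j jk; rewrite !degE deg_edge_vecMn // addrC.
    have -> : (j == k.+1) = false by lia.
    by rewrite muln0 add0r aB //; lia.
  congr (_ *: _); rewrite /umulB /umul scale1r /g; congr (Z _ - Z _).
    by apply/ffunP => v; rewrite /edge_vec !(ffunE, ffunMnE); ring.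
  by apply/ffunP => v; rewrite /edge_vec !(ffunE, ffunMnE) mulrS; ring.
rewrite -scaler_sumr exprS mulN1r scaleNr -scalerN; congr (_ *: _).
rewrite -(big_mkord xpredT (fun i => g i - g i.+1)).
under eq_bigr do rewrite -opprB; rewrite sumrN telescope_sumr //.
have -> : g 0%N = 0.
  apply: (ZB k.+1); rewrite mulr0n addr0 degD degN deg_uexp degD degN.
  rewrite deg_edge_vec // degD.
  rewrite deg_corner_vec ?(ltnW kn) //.
  have := aB k.+1; rewrite !initialE inordK // !ltnn eqxx /=.
  by move=> /(_ (ltnSn k)); lia.
rewrite subr0 /g; congr (- Z _).
rewrite -{1}(prednK L0); apply/ffunP => v; rewrite !(ffunE, ffunMnE) mulrS; ring.
Qed.

Context (t : nat).

Definition exponent (b : {ffun 'I_n.+1 -> 'I_t.+1}) : {ffun 'I_n.+1 -> int} :=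
  [ffun i => (b i)%:Z].

(** Equality of the partial sums of length greater than [k]: the exponents that
    the sums [box_sum k] run through. *)
Definition same_class k a b :=
  [forall j : 'I_n.+2, (k < j)%N ==>
     (deg (initial ord j) (exponent b) == deg (initial ord j) a)].

Lemma same_classP k a b : reflect (forall j, (k < j <= n.+1)%N ->
  deg (initial ord j) (exponent b) = deg (initial ord j) a) (same_class k a b).
Proof.
apply: (iffP forallP) => [H j /andP[kj jn]|H j]; last first.
  by apply/implyP => kj; apply/eqP/H; rewrite kj -ltnS ltn_ord.
by have := H (Ordinal (jn : (j < n.+2)%N)); rewrite kj => /eqP.
Qed.

Lemma same_class0 a b : same_class 0 a b = (exponent b == a).
Proof.
apply/same_classP/eqP => [H|-> //]; apply: initial_inj => -[|j] jn; last exact: H.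
by rewrite /deg !big_pred0.
Qed.

(** A box which is large enough contains each relevant exponent of a power
    series exactly once: its coordinates are the partial sums. *)
Lemma box_sum_class k F a : nonneg F -> deg predT a = t%:Z -> (k <= n)%N ->
  (forall b j, (0 < j <= k)%N ->
     0 <= deg (initial ord j) (exponent b) - deg (initial ord j) a < L%:Z) ->
  box_sum k F a = \sum_(b | same_class k a b) F (exponent b).
Proof.
move=> F0; elim: k a => [|k IH] a at_ kn ab /=.
  under eq_bigl do rewrite same_class0.
  have [Fa|Fa] := eqVneq (F a) 0; first by rewrite big1 // => b /eqP ->.
  have a0 := F0 _ Fa.
  have at' i : (`|a i| < t.+1)%N.
    rewrite ltnS -lez_nat gez0_abs // -at_ /deg (bigD1 i) //= lerDl.
    by rewrite sumr_ge0.
  pose b : {ffun 'I_n.+1 -> 'I_t.+1} := [ffun i => Ordinal (at' i)].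
  have eb : exponent b = a by apply/ffunP => i; rewrite !ffunE /= gez0_abs.
  rewrite (big_pred1 b) ?eb // => b'; apply/eqP/eqP => [E|-> //].
  apply/ffunP => i; apply/val_inj => /=; move: E; rewrite -eb => /ffunP/(_ i).
  by rewrite !ffunE => -[].
have dk (i : 'I_L) j : deg (initial ord j) (a + edge_vec k *+ i) =
    deg (initial ord j) a + (i * (j == k.+1))%:Z.
  by rewrite degD deg_edge_vecMn.
transitivity (\sum_(i < L)
    \sum_(b | same_class k (a + edge_vec k *+ i) b) F (exponent b)).
  apply: eq_bigr => i _; apply: IH; [|exact: ltnW|].
    rewrite degD at_ degMn /edge_vec !degE /= subrr mul0rn addr0 //.
  move=> b j jk; rewrite dk; have -> : (j == k.+1) = false by lia.
  by rewrite muln0 addr0 ab //; lia.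
rewrite (exchange_big_dep (same_class k.+1 a)) /=; last first.
  move=> i b _ /same_classP H; apply/same_classP => j jk; rewrite H ?dk; last by lia.
  have -> : (j == k.+1) = false by lia.
  by rewrite muln0 addr0.
apply: eq_bigr => b /same_classP H.
have /andP[b0 bL] := ab b k.+1 (leqnn _).
set x := _ - _ in b0 bL.
have xL : (`|x| < L)%N by lia.
rewrite (big_pred1 (Ordinal xL)) // => i /=; apply/same_classP/eqP => [{}H|-> j jk].
  apply/val_inj => /=; have := H k.+1; rewrite dk eqxx; lia.
rewrite dk /=; have [->|jk'] := eqVneq j k.+1; first by lia.
by rewrite muln0 addr0 H //; lia.
Qed.

End Telescoping.
Arguments edges {K n} kap k.

(** * Evaluation on the wheel *)

Section Evaluation.
Context (K : fieldType) (M : lmodType K) (n : nat).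
Implicit Types (F Z : lseries n.+1 M) (a : {ffun 'I_n.+1 -> int}).
Implicit Types (u v : 'I_n.+1 -> K) (l : seq (K * ('I_n.+1 * 'I_n.+1))).

Notation ord := (@nat_of_ord n.+1).

(** The value at [u] of the homogeneous component of degree [t]. *)
Definition ev t u F : M :=
  \sum_(b : {ffun 'I_n.+1 -> 'I_t.+1} | (\sum_i b i)%N == t)
    (\prod_i u i ^+ b i) *: F (exponent b).

Lemma nonneg_umul i F : nonneg F -> nonneg (umul i F).
Proof.
move=> F0 a /F0 H j; have := H j; rewrite !ffunE; case: eqP => _ /=; lia.
Qed.

Lemma nonneg_umulB c i j F : nonneg F -> nonneg (umulB c i j F).
Proof.
move=> F0 a; rewrite /umulB; have [E|E _] := eqVneq (umul i F a) 0; last first.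
  exact: (nonneg_umul F0 E).
have [E'|E' _] := eqVneq (umul j F a) 0; last exact: (nonneg_umul F0 E').
by rewrite E E' scaler0 subrr eqxx.
Qed.

Lemma nonneg_mulforms l F : nonneg F -> nonneg (mulforms l F).
Proof. by move=> F0; elim: l => //= f l IH; apply: nonneg_umulB. Qed.

(** The exponents that do not contain [u_i] contribute nothing because [F] has
    no negative exponents; the others are shifted by one. *)
Lemma ev_umul t u i F : nonneg F -> ev t.+1 u (umul i F) = u i *: ev t u F.
Proof.
move=> F0; rewrite /ev.
rewrite (bigID (fun b : {ffun _ -> 'I_t.+2} => (0 < b i)%N)) /=.
rewrite [X in _ + X]big1 ?addr0; last first.
  move=> b /andP[_ bi]; have [->|E] := eqVneq (umul i F (exponent b)) 0.
    by rewrite scaler0.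
  have := F0 _ E i; rewrite !ffunE eqxx; lia.
pose h (b : {ffun 'I_n.+1 -> 'I_t.+1}) : {ffun 'I_n.+1 -> 'I_t.+2} :=
  [ffun j => inord (b j + (j == i))].
pose h' (b : {ffun 'I_n.+1 -> 'I_t.+2}) : {ffun 'I_n.+1 -> 'I_t.+1} :=
  [ffun j => inord (b j - (j == i))].
have hE b j : h b j = (b j + (j == i))%N :> nat.
  by rewrite ffunE inordK //; case: (j == i) (b j) => -[x /= xt]; lia.
rewrite (reindex_onto h h') /=; last first.
  move=> b /andP[/eqP sb bi]; apply/ffunP => j; apply/val_inj.
  rewrite /= hE ffunE inordK; last first.
    have [->|ji] := eqVneq j i; first by have := ltn_ord (b i); lia.
    by move: sb; rewrite (bigD1 i) //= (bigD1 j) //=; lia.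
  by have [->|ji] := eqVneq j i; lia.
rewrite scaler_sumr; apply: eq_big => [b|b _].
  have -> : h' (h b) == b.
    apply/eqP/ffunP => j; apply/val_inj; rewrite /= ffunE inordK hE.
      by rewrite addnK.
    by rewrite addnK.
  rewrite andbT hE eqxx addn1 andbT.
  under eq_bigr do rewrite hE.
  have i1 : (\sum_j (j == i))%N = 1%N.
    by rewrite (bigD1 i) //= eqxx big1 // => j /negPf ->.
  by rewrite big_split /= i1 addn1 eqSS.
rewrite scalerA; congr (_ *: F _).
  under eq_bigr do rewrite hE exprD.
  rewrite big_split /= mulrC; congr (_ * _).
  by rewrite (bigD1 i) //= eqxx expr1 big1 ?mulr1 // => j /negPf ->.
apply/ffunP => j; rewrite /exponent [LHS]ffunE ffunE hE !ffunE.
by case: (j == i); lia.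
Qed.

Lemma ev_mulforms t u l F : nonneg F -> ev (size l + t) u (mulforms l F) =
  (\prod_(f <- l) (u f.2.1 - f.1 * u f.2.2)) *: ev t u F.
Proof.
move=> F0; elim: l => [|[c [i j]] l IH] /=; first by rewrite big_nil scale1r.
have FN : nonneg (mulforms l F) by exact: nonneg_mulforms.
rewrite big_cons /= -scalerA -IH scalerBl -!scalerA -!ev_umul //.
rewrite /ev scaler_sumr -sumrB; apply: eq_bigr => b _.
by rewrite scalerBr !scalerA mulrC.
Qed.

Section PathSum.
Context (m B t : nat).
Hypothesis mn : (m <= n)%N.

Lemma deg_sum T (I : Type) (s : seq I) (f : I -> {ffun 'I_n.+1 -> int}) :
  deg T (\sum_(i <- s) f i) = \sum_(i <- s) deg T (f i).
Proof.
apply: (big_morph (deg T)) => [a b|]; first exact: degD.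
by rewrite /deg big1 // => i _; rewrite ffunE.
Qed.

Lemma deg_exponent_ge0 T (b : {ffun 'I_n.+1 -> 'I_t.+1}) : 0 <= deg T (exponent b).
Proof. by apply: deg_ge0 => i; rewrite ffunE. Qed.

Lemma deg_exponent_le T (b : {ffun 'I_n.+1 -> 'I_t.+1}) :
  deg T (exponent b) <= (t * n.+1)%:Z.
Proof.
rewrite /deg (@le_trans _ _ (\sum_(i : 'I_n.+1) t%:Z)) //; last first.
  by rewrite sumr_const card_ord pmulrn mulrzz.
rewrite big_mkcond ler_sum // => i _; case: (T i) => //.
by rewrite ffunE lez_nat -ltnS.
Qed.

(** The box starts just below the cone in all the partial sums, with
    strictly decreasing values, and is so long that the exponents of
    [u_1, ..., u_m] at the surviving corner are all below [- B]. *)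
Lemma path_class_sum Z (b0 : {ffun 'I_n.+1 -> 'I_t.+1}) :
  cone ord B Z ->
  (forall a, (forall j, (0 < j <= m)%N -> a (inord j) < - B%:Z) -> Z a = 0) ->
  nonneg (mulforms (edges (fun=> 1) m) Z) -> deg predT (exponent b0) = t%:Z ->
  \sum_(b : {ffun 'I_n.+1 -> 'I_t.+1} | same_class m (exponent b0) b)
    mulforms (edges (fun=> 1) m) Z (exponent b) = 0.
Proof.
move=> ZB Z0 N0 tb0.
(* [base] has partial sums [- (B + (j - 1) (B + 1))], [1 <= j <= m]; the side
   [L] covers the degrees of the exponents in the class and pushes the
   exponent of [u_m] below [- B]. *)
pose L := (t * n.+1 + B.+1 * m.+1 + B).+1.
pose s j := deg (initial ord j) (exponent b0).
pose w j := (`|s j.+1| + B + j * B.+1)%N.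
pose base := exponent b0 - \sum_(j <- iota 0 m) edge_vec n j *+ w j.
have dbase j : deg (initial ord j) base =
    if (0 < j <= m)%N then - (B + j.-1 * B.+1)%:Z else s j.
  rewrite /base degD degN deg_sum -/(s j).
  rewrite (eq_big_seq (fun i => (w i * (j == i.+1))%:Z)); last first.
    by move=> i; rewrite mem_iota => im; rewrite deg_edge_vecMn //; lia.
  have [/andP[j0 jm]|jm] := boolP (0 < j <= m)%N.
    rewrite (bigD1_seq j.-1) ?iota_uniq ?mem_iota //=; last by lia.
    rewrite prednK // eqxx muln1 big1 ?addr0; last first.
      by move=> i ij; have -> : (j == i.+1) = false; [lia|rewrite muln0].
    rewrite /w prednK //; have := deg_exponent_ge0 (initial ord j) b0.
    by rewrite -/(s j); lia.
  rewrite big1_seq ?subr0 // => i; rewrite mem_iota => im.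
  by have -> : (j == i.+1) = false; [lia|rewrite muln0].
have baset : deg predT base = t%:Z.
  rewrite /base degD degN tb0 deg_sum big1 ?subr0 // => i _.
  by rewrite degMn /edge_vec degD degN !deg_uexp subrr mul0rn.
have lejm j : (j <= m)%N -> (j * B.+1 <= m * B.+1)%N by rewrite leq_mul2r orbC => ->.
have E : \sum_(b : {ffun 'I_n.+1 -> 'I_t.+1} | same_class m (exponent b0) b)
      mulforms (edges (fun=> 1) m) Z (exponent b) =
    box_sum L m (mulforms (edges (fun=> 1) m) Z) base.
  rewrite (@box_sum_class _ _ _ _ t) //.
    apply: eq_bigl => b; apply/same_classP/same_classP => H j jm; rewrite H // dbase.
      by have -> : (0 < j <= m)%N = false by lia.
    by have -> : (0 < j <= m)%N = false by lia.
  move=> b j jm; rewrite dbase jm.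
  have := deg_exponent_ge0 (initial ord j) b; have := deg_exponent_le (initial ord j) b.
  have jm' : (j.-1 <= m)%N by lia.
  have := lejm _ jm'; rewrite /L (mulnS B.+1) (mulnC B.+1).
  move: (j.-1 * _)%N (m * _)%N (t * _)%N (deg _ _) => x1 x2 x3 x4; lia.
rewrite E (@box_sum_edges _ _ _ _ B) //; last first.
  by move=> j jm; rewrite dbase jm; move: (j.-1 * _)%N => x1; lia.
rewrite Z0 ?scaler0 // => j jm.
have jn : (j < n.+1)%N by lia.
have : deg (initial ord j.+1) (base + corner_vec n L m) =
       deg (initial ord j) (base + corner_vec n L m) +
       (base + corner_vec n L m) (inord j).
  by rewrite -[in X in X = _](inordK jn) deg_initialS inordK.
rewrite !(degD _ base) !dbase jm !deg_corner_vec //.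
have -> : (j == 0%N) = false by lia.
have -> : (j <= m)%N by lia.
have e : (j * B.+1 = j.-1 * B.+1 + B.+1)%N.
  by rewrite -mulSnr prednK //; case/andP: jm.
rewrite /=; have [jm'|jm'] := ltnP j m.
  rewrite /= in jm' *; rewrite e; move: (j.-1 * _)%N => x1; lia.
have -> : j = m by lia.
have := deg_exponent_le (initial ord m.+1) b0; rewrite -/(s _).
have jm2 : (m.-1 <= m)%N by lia.
have := lejm _ jm2; rewrite /L (mulnS B.+1) (mulnC B.+1).
move: (m.-1 * _)%N (m * _)%N (t * _)%N (s m.+1) => x1 x2 x3 x4; lia.
Qed.

(** The exponents of total degree [t] split into the classes of
    [path_class_sum]. *)
Lemma path_sum Z :
  cone ord B Z ->
  (forall a, (forall j, (0 < j <= m)%N -> a (inord j) < - B%:Z) -> Z a = 0) ->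
  nonneg (mulforms (edges (fun=> 1) m) Z) ->
  \sum_(b : {ffun 'I_n.+1 -> 'I_t.+1} | (\sum_i b i)%N == t)
     mulforms (edges (fun=> 1) m) Z (exponent b) = 0.
Proof.
move=> ZB Z0 N0.
have tE (b : {ffun 'I_n.+1 -> 'I_t.+1}) :
    deg predT (exponent b) = (\sum_i b i)%N%:Z.
  by rewrite -natz natr_sum; apply: eq_bigr => i _; rewrite ffunE natz.
(* The key of a class: its partial sums of length greater than [m]. *)
pose key (b : {ffun 'I_n.+1 -> 'I_t.+1}) : {ffun 'I_n.+2 -> 'I_t.+1} :=
  [ffun j : 'I_n.+2 =>
     inord (if (m < j)%N then `|deg (initial ord j) (exponent b)|%N else 0)].
rewrite (partition_big key predT) //= big1 // => k _.
have [b0 /andP[/eqP tb0 /eqP kb0]|nob] := pickP (fun b : {ffun 'I_n.+1 -> 'I_t.+1} =>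
  ((\sum_i b i)%N == t) && (key b == k)); last by rewrite big_pred0.
rewrite -[RHS](path_class_sum ZB Z0 N0 (b0 := b0)); last by rewrite tE tb0.
have le_t (b : {ffun 'I_n.+1 -> 'I_t.+1}) j : (\sum_i b i)%N = t ->
    (`|deg (initial ord j) (exponent b)| < t.+1)%N.
  move=> bt; suff : deg (initial ord j) (exponent b) <= t%:Z.
    by have := deg_exponent_ge0 (initial ord j) b; lia.
  have <- : deg predT (exponent b) = t%:Z by rewrite tE bt.
  rewrite /deg [leRHS](bigID (initial ord j)) /= lerDl.
  by rewrite sumr_ge0 // => i _; rewrite ffunE.
apply: eq_bigl => b; rewrite -kb0; apply/andP/same_classP => [[/eqP bt /eqP kb] j jm|H].
  have jn : (j < n.+2)%N by lia.
  move/ffunP/(_ (Ordinal jn)): kb; rewrite !ffunE /=.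
  have -> : (m < j)%N by lia.
  move=> /(congr1 val); rewrite /= !inordK ?le_t //.
  have := deg_exponent_ge0 (initial ord j) b.
  by have := deg_exponent_ge0 (initial ord j) b0; lia.
have bt : (\sum_i b i)%N = t.
  suff : deg predT (exponent b) = deg predT (exponent b0) by rewrite !tE tb0 => -[].
  have pT a : deg predT a = deg (initial ord n.+1) a.
    by apply: eq_bigl => i; rewrite initialE ltn_ord.
  by rewrite !pT H // ltnS mn /=.
split; first by rewrite bt.
apply/eqP/ffunP => j; rewrite !ffunE; case: ifP => // mj.
by rewrite H // mj -ltnS ltn_ord.
Qed.

(** Rescaling of the variables by the point [u]. When [u_i = c u_j] it turns the
    form [u_i - c u_j] into a multiple of [u_i - u_j]. *)
Definition twist u F : lseries n.+1 M :=
  fun a => (\prod_i u i ^ a i) *: F a.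

Lemma twist_umulB u c i j F : (forall i, u i != 0) -> u i = c * u j ->
  twist u (umulB c i j F) = (fun a => u i *: umulB 1 i j (twist u F) a).
Proof.
move=> u0 uij; apply/funext => a; rewrite /twist /umulB /umul.
have E k : \prod_v u v ^ a v = u k * \prod_v u v ^ (a - uexp k) v.
  rewrite (bigD1 k) //= [in RHS](bigD1 k) //= mulrA !ffunE eqxx.
  rewrite -{2}[u k]expr1z -expfzDr // addrCA subrr addr0; congr (_ * _).
  by apply: eq_bigr => v /negPf vk; rewrite !ffunE vk subr0.
rewrite !scalerBr scale1r !scalerA {1}(E i); congr (_ - _ *: _).
by rewrite (E j) uij; ring.
Qed.

Lemma twist_edges u kap k F : (forall i, u i != 0) ->
  (forall j, (j < k)%N -> u (inord j) = kap j * u (inord j.+1)) ->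
  twist u (mulforms (edges kap k) F) =
  (fun a => (\prod_(j < k) u (inord j)) *:
            mulforms (edges (fun=> 1) k) (twist u F) a).
Proof.
move=> u0; elim: k F => [|k IH] F uk.
  by apply/funext => a; rewrite big_ord0 scale1r.
rewrite !mulforms_edges_recr IH; last by move=> j jk; apply: uk; lia.
rewrite (twist_umulB _ u0 (uk _ (ltnSn k))) mulformsZ; apply/funext => a.
by rewrite scalerA big_ord_recr.
Qed.

(** If [F] is the expansion of [N / prod E_j], its coefficients far in the
    direction of negative [u_1, ..., u_m] are, up to nonzero factors, values
    of [N] on the common zeros of the [E_j]: there the expansions of all the
    monomials of [N] contribute. *)
Lemma wheel_residue kap u F :
  cone ord B F ->
  (forall a, (forall j, (0 < j <= m)%N -> a (inord j) < - B%:Z) -> F a = 0) ->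
  nonneg (mulforms (edges kap m) F) -> (forall i, u i != 0) ->
  (forall j, (j < m)%N -> u (inord j) = kap j * u (inord j.+1)) ->
  ev t u (mulforms (edges kap m) F) = 0.
Proof.
move=> FB Fz F0 u0 uk.
have TE := twist_edges F u0 uk.
set c := \prod_(j < m) _ in TE.
have c0 : c != 0 by apply/prodf_neq0 => j _.
have T0 : nonneg (mulforms (edges (fun=> 1) m) (twist u F)).
  move=> a aN; apply: F0; apply: contraNneq aN => aN.
  have := congr1 (fun G : lseries n.+1 M => G a) TE.
  by rewrite /twist aN scaler0 => /esym/eqP; rewrite scaler_eq0 (negPf c0).
transitivity (c *: \sum_(b : {ffun 'I_n.+1 -> 'I_t.+1} | (\sum_i b i)%N == t)
    mulforms (edges (fun=> 1) m) (twist u F) (exponent b)).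
  rewrite scaler_sumr; apply: eq_bigr => b _.
  have := congr1 (fun G : lseries n.+1 M => G (exponent b)) TE => /= <-.
  by rewrite /twist; congr (_ *: _); apply: eq_bigr => i _; rewrite ffunE.
rewrite path_sum ?scaler0 // => [k a ak|a az].
  by rewrite /twist (FB k) ?scaler0.
by rewrite /twist Fz ?scaler0.
Qed.

End PathSum.

End Evaluation.

(** * Cancelling linear forms on a linear subspace *)

Section Lines.
Context (K : fieldType) (q : K) (M : lmodType K).
Hypotheses (q0 : q != 0) (qroot : not_root_of_unity q).

Lemma expf_inj k l : (k < l)%N -> q ^+ k != q ^+ l.
Proof.
move=> kl; have /qroot : (0 < l - k)%N by rewrite subn_gt0.
apply: contraNneq => E; apply/eqP/(mulfI (expf_neq0 k q0)).
by rewrite -exprD subnKC ?mulr1 // ltnW.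
Qed.

(** The coefficients are vectors, so instead of counting roots one compares the
    values at [x] and [q x]: the combination [F (q x) - q^N F (x)] has lost
    its term of degree [N]. *)
Lemma poly_vec_eq0 N (a : nat -> M) :
  (forall x, x != 0 -> \sum_(k < N) x ^+ k *: a k = 0) ->
  forall k, (k < N)%N -> a k = 0.
Proof.
elim: N a => // N IH a aN.
have aN0 k : (k < N)%N -> a k = 0.
  move=> kN; have := IH (fun k => (q ^+ k - q ^+ N) *: a k) _ k kN.
  move=> E; have /eqP : (q ^+ k - q ^+ N) *: a k = 0.
    apply: E => x x0; transitivity (\sum_(k < N.+1) (q * x) ^+ k *: a k -
        q ^+ N *: \sum_(k < N.+1) x ^+ k *: a k); last first.
      by rewrite !aN ?mulf_neq0 // scaler0 subr0.
    rewrite scaler_sumr -sumrB big_ord_recr /=.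
    rewrite !scalerA -scalerBl exprMn subrr scale0r addr0.
    by apply: eq_bigr => i _; rewrite !scalerA -scalerBl exprMn; congr (_ *: _); ring.
  by rewrite scaler_eq0 subr_eq0 (negPf (expf_inj kN)) => /eqP.
move=> k; rewrite ltnS leq_eqVlt => /predU1P[->|]; last exact: aN0.
have := aN 1 (oner_neq0 _); rewrite big_ord_recr /= big1 ?add0r => [|i _].
  by rewrite expr1n scale1r.
by rewrite aN0 ?scaler0.
Qed.

Lemma line_eq0 (I : finType) (Q : pred I) (p : I -> {poly K}) (a : I -> M) x0 :
  (forall x, x != x0 -> \sum_(i | Q i) (p i).[x] *: a i = 0) ->
  \sum_(i | Q i) (p i).[0] *: a i = 0.
Proof.
have [->|x00] := eqVneq x0 0; last by apply; rewrite eq_sym.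
move=> H; pose N := (\max_(i : I) size (p i)).+1.
have E x : \sum_(i | Q i) (p i).[x] *: a i =
    \sum_(k < N) x ^+ k *: \sum_(i | Q i) (p i)`_k *: a i.
  under [RHS]eq_bigr do rewrite scaler_sumr.
  rewrite exchange_big; apply: eq_bigr => i _ /=.
  rewrite (@horner_coef_wide _ N); last by rewrite leqW // (leq_bigmax i).
  by rewrite scaler_suml; apply: eq_bigr => k _; rewrite scalerA mulrC.
rewrite E big1 // => k _.
have -> : \sum_(i | Q i) (p i)`_k *: a i = 0; last by rewrite scaler0.
apply: (poly_vec_eq0 (N := N) (a := fun k => \sum_(i | Q i) (p i)`_k *: a i)) => //.
by move=> x /H; rewrite E.
Qed.

Definition form_at n (u : 'I_n -> K) (f : K * ('I_n * 'I_n)) : K :=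
  u f.2.1 - f.1 * u f.2.2.

(** One form is removed at a time. At [u], take the line through [u] in the
    direction of a point where the form does not vanish: along it the form has
    at most one zero, and the rest of the product is a polynomial. *)
Lemma cancel_forms n t (F : lseries n.+1 M) (S : ('I_n.+1 -> K) -> Prop)
    (l : seq (K * ('I_n.+1 * 'I_n.+1))) :
  (forall u v x, S u -> S v -> S (fun i => u i + x * v i)) ->
  (forall f, f \in l -> exists2 v, S v & form_at v f != 0) ->
  (forall u, S u -> (\prod_(f <- l) form_at u f) *: ev t u F = 0) ->
  forall u, S u -> ev t u F = 0.
Proof.
move=> Slin; elim: l => [|f l IH] lS lF.
  by move=> u /lF; rewrite big_nil scale1r.
apply: IH => [g gl|u Su]; first by apply: lS; rewrite inE gl orbT.
have [v Sv vf] := lS f (mem_head _ _).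
pose lin i : {poly K} := (u i)%:P + (v i) *: 'X.
pose p (b : {ffun 'I_n.+1 -> 'I_t.+1}) : {poly K} :=
  (\prod_(g <- l) (lin g.2.1 - g.1 *: lin g.2.2)) * \prod_i lin i ^+ b i.
have pE x b : (p b).[x] =
    (\prod_(g <- l) form_at (fun i => u i + x * v i) g) * 
    \prod_i (u i + x * v i) ^+ b i.
  rewrite /p hornerM !horner_prod; congr (_ * _).
    by apply: eq_bigr => g _; rewrite /form_at !hornerE; ring.
  by apply: eq_bigr => i _; rewrite /lin !hornerE mulrC.
have E x : (\prod_(g <- l) form_at (fun i => u i + x * v i) g) *:
    ev t (fun i => u i + x * v i) F =
    \sum_(b : {ffun 'I_n.+1 -> 'I_t.+1} | (\sum_i b i)%N == t)
      (p b).[x] *: F (exponent b).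
  by rewrite scaler_sumr; apply: eq_bigr => b _; rewrite pE scalerA.
have u0 : (fun i => u i + 0 * v i) = u.
  by apply/funext => i; rewrite mul0r addr0.
rewrite -{1 2}u0 E; apply: (line_eq0 (x0 := - form_at u f / form_at v f)) => x xf.
rewrite -E; apply/eqP; have := lF _ (Slin _ _ x Su Sv).
rewrite big_cons -scalerA => /eqP; rewrite scaler_eq0 => /orP[|//].
have -> : form_at (fun i => u i + x * v i) f = form_at u f + x * form_at v f.
  by rewrite /form_at; ring.
rewrite addrC addr_eq0 => /eqP E'; case/negP: xf; apply/eqP.
by rewrite -E' mulfK.
Qed.

End Lines.

(** * Clearing the denominators of one word *)

Section PairOperators.
Context (K : fieldType) (M : lmodType K) (n : nat).
Context (kap : 'I_n * 'I_n -> K).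
Hypothesis kap0 : forall p, kap p != 0.
Implicit Types (F X : lseries n M) (ps : seq ('I_n * 'I_n)) (rho : 'I_n -> nat).

Definition mulpairs ps F := mulforms [seq (kap p, p) | p <- ps] F.

Lemma mulpairs_cat ps qs F : mulpairs (ps ++ qs) F = mulpairs ps (mulpairs qs F).
Proof. by rewrite /mulpairs map_cat mulforms_cat. Qed.

Lemma mulpairsC ps qs F : mulpairs ps (mulpairs qs F) = mulpairs qs (mulpairs ps F).
Proof. exact: mulformsC. Qed.

Lemma mulpairs_perm ps qs F : perm_eq ps qs -> mulpairs ps F = mulpairs qs F.
Proof. by move=> pq; apply/mulforms_perm/perm_map. Qed.

(** The denominators of a word in which the variable [i] has rank [rho i]. *)
Definition pairs rho : seq ('I_n * 'I_n) :=
  [seq p <- enum {: 'I_n * 'I_n} | (rho p.1 < rho p.2)%N].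

Lemma mem_pairs rho p : (p \in pairs rho) = (rho p.1 < rho p.2)%N.
Proof. by rewrite mem_filter mem_enum andbT. Qed.

Lemma pairs_uniq rho : uniq (pairs rho).
Proof. by rewrite filter_uniq ?enum_uniq. Qed.

Definition divpairs ps F :=
  foldr (fun p => udivB (kap p) p.1 p.2) F ps.

Lemma cone_divpairs rho ps F : {subset ps <= pairs rho} -> cone rho 0 F ->
  cone rho (size ps) (divpairs ps F).
Proof.
move=> + F0; elim: ps => //= p ps IH ppr.
apply: cone_udivB.
  by have := ppr p (mem_head _ _); rewrite mem_pairs.
by apply: IH => q qs; rewrite ppr // inE qs orbT.
Qed.

Lemma divpairsK rho ps F : {subset ps <= pairs rho} -> cone rho 0 F ->
  mulpairs ps (divpairs ps F) = F.
Proof.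
move=> + F0; elim: ps => //= p ps IH ppr.
have psr : {subset ps <= pairs rho} by move=> q qs; rewrite ppr // inE qs orbT.
rewrite -[X in _ = X]IH //.
rewrite -[p :: ps]cat1s mulpairs_cat mulpairsC; congr mulpairs.
rewrite /mulpairs /=; apply: (udivBK (rho := rho) (B := size ps)) => //.
  by have := ppr p (mem_head _ _); rewrite mem_pairs.
exact: cone_divpairs.
Qed.

Lemma supp_ge_mulpairsK rho (T : pred 'I_n) B t ps X :
  (forall p, p \in ps -> (rho p.1 < rho p.2)%N /\ T p.1 = T p.2) ->
  cone rho B X -> supp_ge T t (mulpairs ps X) -> supp_ge T (size ps + t) X.
Proof.
elim: ps t => // p ps IH t psT XB Xt.
have [pr pT] := psT p (mem_head _ _).
rewrite /= addSnnS; apply: IH => // [r rps|].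
  by apply: psT; rewrite inE rps orbT.
apply: (supp_ge_umulBK _ pr (kap0 p) pT Xt).
exact: (cone_mulforms [seq (kap p, p) | p <- ps] XB).
Qed.

(** Once the denominators between [T] and its complement are cleared, the
    remaining ones are homogeneous for the [T]-degree, and the numerator is a
    power series: the [T]-degree is bounded below. *)
Lemma supp_ge_cut rho (T : pred 'I_n) B ps X :
  uniq ps ->
  (forall p, (rho p.1 < rho p.2)%N -> T p.1 != T p.2 -> p \in ps) ->
  cone rho B X -> nonneg (mulpairs (pairs rho) X) ->
  supp_ge T (size (pairs rho)) (mulpairs ps X).
Proof.
move=> ups psT XB N0; pose cr : pred ('I_n * 'I_n) := fun p => T p.1 != T p.2.
pose c := filter cr (pairs rho); pose nc := filter (predC cr) (pairs rho).
have cps : perm_eq c (filter (mem c) ps).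
  apply: uniq_perm => [||p]; [exact/filter_uniq/pairs_uniq|exact: filter_uniq|].
  rewrite [RHS]mem_filter /=; have [|//] := boolP (p \in c).
  by rewrite mem_filter mem_pairs => /andP[pT pr]; rewrite psT.
have -> : mulpairs ps X = mulpairs (filter (predC (mem c)) ps) (mulpairs c X).
  rewrite (mulpairs_perm _ cps) mulpairsC -mulpairs_cat; apply: mulpairs_perm.
  by rewrite perm_sym perm_filterC.
apply: supp_ge_mulforms; apply: (@supp_geW _ _ _ _ (size nc + 0)).
  by rewrite addn0 size_filter count_size.
apply: supp_ge_mulpairsK (cone_mulforms _ XB) _ => [p|].
  by rewrite mem_filter mem_pairs /= negbK => /andP[/eqP].
rewrite -mulpairs_cat (@mulpairs_perm _ (pairs rho)).
  move=> a aT; apply/eqP; apply: contraTT aT => /N0 a0.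
  by rewrite -leNgt oppr0 deg_ge0.
by rewrite perm_catC perm_filterC.
Qed.

End PairOperators.

Section WordSeries.
Context (K : fieldType) (q : K) (r : nat) (D : affine_datum r) (M : lmodType K).
Hypothesis q0 : q != 0.

Definition den_coef n (c : 'I_n -> 'I_r) (p : 'I_n * 'I_n) : K :=
  q ^ fform D (c p.1) (c p.2).

Lemma den_coef_neq0 n (c : 'I_n -> 'I_r) p : den_coef c p != 0.
Proof. exact: expfz_neq0. Qed.

(** The numerator, up to sign, in the formula that relates a weight function to
    Wbar. *)
Definition numer n (c : 'I_n -> 'I_r) : seq (K * ('I_n * 'I_n)) :=
  [seq (1, p) | p <- wpairs n & c p.1 == c p.2] ++
  [seq (0, (i, i)) | i <- enum 'I_n].

Lemma wsubst_nonneg n (c : 'I_n -> 'I_r) (W : pseries (wcount c) M) :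
  nonneg (wsubst W).
Proof.
by move=> a; rewrite /wsubst; case: ifP => [/forallP //|_]; rewrite eqxx.
Qed.

Lemma cone0 n (rho : 'I_n -> nat) (F : lseries n M) : nonneg F -> cone rho 0 F.
Proof.
move=> F0 k a ak; apply/eqP; apply: contraTT ak => /F0 a0.
by rewrite -leNgt oppr0 deg_ge0.
Qed.

Lemma weight_rhs_num n (c : 'I_n -> 'I_r) (W : pseries (wcount c) M) :
  weight_rhs q D W = (fun a => (-1) ^+ shuffle c *:
    mulforms (numer c) (divpairs (den_coef c) (wpairs n) (wsubst W)) a).
Proof.
apply/funext => a; rewrite /weight_rhs /numer mulforms_cat; congr (_ *: _).
rewrite /mulforms !foldr_map; congr (foldr _ _ _ a).
by elim: (Finite.enum _) => //= i s ->; rewrite umulE.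
Qed.

Lemma wpairsE n : wpairs n = pairs (@nat_of_ord n).
Proof. by []. Qed.

Lemma cone_weight_rhs n (c : 'I_n -> 'I_r) (W : pseries (wcount c) M) :
  cone (@nat_of_ord n) (size (wpairs n)) (weight_rhs q D W).
Proof.
rewrite weight_rhs_num => k a ak.
rewrite (cone_mulforms (rho := @nat_of_ord n) (B := size (wpairs n)) _ _ ak) ?scaler0 //.
by apply: cone_divpairs => //; apply/cone0/wsubst_nonneg.
Qed.

Lemma mulpairs_weight_rhs n (c : 'I_n -> 'I_r) (W : pseries (wcount c) M) :
  mulpairs (den_coef c) (wpairs n) (weight_rhs q D W) =
  (fun a => (-1) ^+ shuffle c *: mulforms (numer c) (wsubst W) a).
Proof.
rewrite weight_rhs_num /mulpairs mulformsZ mulformsC; apply/funext => a.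
congr (_ *: mulforms _ _ a).
apply: (@divpairsK _ _ _ _ _ (@nat_of_ord n)) => //; first exact: den_coef_neq0.
exact/cone0/wsubst_nonneg.
Qed.

End WordSeries.

(** A weight function comes in the variables of the positions of its own word.
    Here it is rewritten in common variables, [tau i] being the variable at
    position [i]. *)
Section Reindexing.
Context (K : fieldType) (M : lmodType K) (n : nat).
Context (rho : 'I_n -> nat) (tau : 'I_n -> 'I_n).
Hypothesis rhoK : forall i, rho (tau i) = i.

Definition relabel (F : lseries n M) : lseries n M := fun a => F [ffun i => a (tau i)].

Lemma tau_inj : injective tau.
Proof. by move=> i j /(congr1 rho); rewrite !rhoK => /val_inj. Qed.

Lemma relabel_umulB c i j F :
  umulB c (tau i) (tau j) (relabel F) = relabel (umulB c i j F).
Proof.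
apply/funext => a; rewrite /relabel /umulB /umul; congr (F _ - c *: F _).
  by apply/ffunP => k; rewrite !ffunE (inj_eq tau_inj).
by apply/ffunP => k; rewrite !ffunE (inj_eq tau_inj).
Qed.

Lemma relabel_mulforms l F :
  mulforms [seq (f.1, (tau f.2.1, tau f.2.2)) | f <- l] (relabel F) =
  relabel (mulforms l F).
Proof. by elim: l => //= f l ->; rewrite relabel_umulB. Qed.

Lemma relabel_cone B F : cone (@nat_of_ord n) B F -> cone rho B (relabel F).
Proof.
move=> FB k a ak; apply: (FB k); move: ak; congr (_ < _).
rewrite /deg (reindex_inj tau_inj); apply: eq_big => i; rewrite ?initialE ?rhoK //.
by move=> _; rewrite ffunE.
Qed.

Lemma relabel_nonneg F : nonneg F -> nonneg (relabel F).
Proof.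
move=> F0 a /F0 H i; have [g _ gK] := injF_bij tau_inj.
by have := H (g i); rewrite ffunE gK.
Qed.

Lemma pairs_tau :
  perm_eq [seq (tau p.1, tau p.2) | p <- pairs (@nat_of_ord n)] (pairs rho).
Proof.
have [g gK Kg] := injF_bij tau_inj.
apply: uniq_perm; rewrite ?pairs_uniq //.
  rewrite map_inj_uniq ?pairs_uniq // => -[a b] [a' b'] [/tau_inj -> /tau_inj ->].
  by [].
move=> [i j]; rewrite mem_pairs /=; apply/mapP/idP => [[[a b]]|ij].
  by rewrite mem_pairs /= => ab [-> ->]; rewrite !rhoK.
by exists (g i, g j); rewrite /= ?Kg // mem_pairs /= -(rhoK (g i)) -(rhoK (g j)) !Kg.
Qed.

Lemma relabel_mulpairs (kap : 'I_n * 'I_n -> K) F :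
  mulpairs kap (pairs rho) (relabel F) =
  relabel (mulpairs (fun p => kap (tau p.1, tau p.2)) (pairs (@nat_of_ord n)) F).
Proof.
rewrite -(mulpairs_perm kap (relabel F) pairs_tau) /mulpairs -relabel_mulforms -!map_comp.
by congr mulforms; apply: eq_map => -[i j].
Qed.

End Reindexing.
Arguments numer {K r n} c.

(** * The Serre relation for weight functions *)

(** A permutation with no descent at consecutive places is increasing. *)
Lemma perm_descent m (sigma : 'S_m) : sigma != 1%g ->
  exists k l : 'I_m, l = k.+1 :> nat /\ (sigma l < sigma k)%N.
Proof.
apply: contra_neqP => nodesc; apply/permP => k; rewrite perm1.
have k0 := k; pose l := [seq val (sigma k) | k <- enum 'I_m].
have lE i (im : (i < m)%N) : nth 0%N l i = sigma (Ordinal im).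
  by rewrite (nth_map k0) ?size_enum_ord // -[i in LHS]/(val (Ordinal im)) nth_ord_enum.
suff El : l = iota 0 m.
  apply/val_inj => /=; have := lE k (ltn_ord k); rewrite El nth_iota // add0n.
  by move=> ->; congr (nat_of_ord (sigma _)); apply/val_inj.
apply: (irr_sorted_eq ltn_trans ltnn); last 1 first.
- move=> i; rewrite mem_iota add0n /=; apply/mapP/idP => [[j _ ->]|im].
    exact: ltn_ord.
  by exists ((sigma^-1)%g (Ordinal im)); rewrite ?mem_enum // permKV.
- apply/(sortedP 0%N) => i; rewrite size_map size_enum_ord => im.
  have im' := ltnW im; rewrite (lE _ im') (lE _ im) ltn_neqAle; apply/andP; split.
    by rewrite val_eqE (inj_eq perm_inj) -val_eqE /= neq_ltn ltnSn.
  by rewrite leqNgt; apply/negP => ?; apply: nodesc; exists (Ordinal im'), (Ordinal im).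
- exact: iota_ltn_sorted.
Qed.

Section LinearOnSubalgebra.
Context (K : fieldType) (A : algType K) (G : set A).

Lemma gen_subalg0 : gen_subalg G 0.
Proof. by rewrite -(scale0r (1 : A)); apply/GenZ/Gen1. Qed.

Lemma gen_subalg_sum (I : Type) (s : seq I) (c : I -> K) (z : I -> A) :
  (forall i, gen_subalg G (z i)) -> gen_subalg G (\sum_(i <- s) c i *: z i).
Proof.
move=> zG; elim/big_rec: _ => [|i w _ wG]; first exact: gen_subalg0.
by apply: GenD => //; apply: GenZ.
Qed.

Lemma gen_subalg_prod (I : Type) (s : seq I) (z : I -> A) :
  (forall i, gen_subalg G (z i)) -> gen_subalg G (\prod_(i <- s) z i).
Proof.
by move=> zG; elim/big_rec: _ => [|i w _ wG]; [exact: Gen1|apply: GenM].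
Qed.

(** The maps [P] and [pi] are linear only on subalgebras. *)
Lemma linear_on_sum (V : lmodType K) (f : A -> V) :
  (forall c z z', gen_subalg G z -> gen_subalg G z' ->
     f (c *: z + z') = c *: f z + f z') ->
  forall (I : Type) (s : seq I) (c : I -> K) (z : I -> A),
  (forall i, gen_subalg G (z i)) ->
  f (\sum_(i <- s) c i *: z i) = \sum_(i <- s) c i *: f (z i).
Proof.
move=> fl I s c z zG; elim: s => [|i s IH].
  rewrite !big_nil -[X in f X](addNr (0 : A)) -scaleN1r fl ?scaleN1r ?addNr //;
  exact: gen_subalg0.
by rewrite !big_cons fl ?IH //; apply: gen_subalg_sum.
Qed.

End LinearOnSubalgebra.

Section Words.
Context (K : fieldType) (q : K) (r : nat) (D : affine_datum r).
Context (A : algType K) (M : lmodType K) (x : dj_gen r -> A) (y : cur_gen r -> A).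
Context (eps : {lrmorphism A -> K^o}) (P : A -> A) (pi : A -> M).
Context (Wbar : forall nu : 'I_r -> nat, pseries nu M).
Arguments Wbar : clear implicits.
Hypothesis q0 : q != 0.
Hypotheses (yrel : cur_rel q D y) (Pproj : is_projection x y eps P).
Hypotheses (piquo : is_quotient (Ub_plus x) (Jideal x y) pi).
Hypotheses (WbarP : is_Wbar q D y P pi Wbar).

Context (n : nat) (c : 'I_n.+1 -> 'I_r).

Definition f_word (ws : seq 'I_n.+1) (a : {ffun 'I_n.+1 -> int}) : A :=
  \prod_(v <- ws) y (Curf (c v) (a v)).

(** The entries of [ws] are variables, the letter of [v] being [c v]. *)
Definition word_series (ws : seq 'I_n.+1) : lseries n.+1 M :=
  fun a => pi (P (f_word ws a)).

Lemma f_word_UF ws a : UF x y (f_word ws a).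
Proof.
by apply: gen_subalg_prod => v; apply: GenIn; left; right; exists (c v), (a v).
Qed.

Lemma word_series_sum (I : finType) (k : I -> K) (w : I -> seq 'I_n.+1) :
  (forall a, \sum_i k i *: f_word (w i) a = 0) ->
  forall a, \sum_i k i *: word_series (w i) a = 0.
Proof.
move=> w0 a; case: Pproj => PU Plin _; case: piquo => pilin _ _.
rewrite /word_series -(linear_on_sum pilin); last first.
  by move=> i; case: (PU _ (f_word_UF (w i) a)).
rewrite -(linear_on_sum Plin) ?w0; last by move=> i; apply: f_word_UF.
have e (V : lmodType K) (f : A -> V) G :
    (forall c z z', gen_subalg G z -> gen_subalg G z' ->
     f (c *: z + z') = c *: f z + f z') -> f 0 = 0.
  move=> /linear_on_sum /(_ nat [::] (fun=> 0) (fun=> 1)).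
  by rewrite !big_nil; apply=> _; apply: Gen1.
by rewrite (e _ _ _ Plin) (e _ _ _ pilin).
Qed.

(** What is used of the words other than the reference one: their numerators
    enter only as power series. *)
Lemma word_series_cone_den ws : perm_eq ws (enum 'I_n.+1) ->
  let rho := fun v => index v ws in
  cone rho (size (wpairs n.+1)) (word_series ws) /\
  nonneg (mulpairs (den_coef q D c) (pairs rho) (word_series ws)).
Proof.
move=> pws rho; have sws : size ws = n.+1 by rewrite (perm_size pws) size_enum_ord.
have uws : uniq ws by rewrite (perm_uniq pws) enum_uniq.
pose tau (i : 'I_n.+1) := nth ord0 ws i.
have rhoK i : rho (tau i) = i by rewrite /rho /tau index_uniq // sws.
case: WbarP => _ /(_ n.+1 (c \o tau)) /funext E.
have -> : word_series ws = relabel tau (weight_rhs q D (Wbar (wcount (c \o tau)))).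
  rewrite -E; apply/funext => a; rewrite /word_series /relabel /weight_function /f_word.
  congr (pi (P _)); rewrite (big_nth ord0) big_mkord sws.
  by apply: eq_bigr => i _; rewrite ffunE.
split; first by apply: relabel_cone => //; apply: cone_weight_rhs.
rewrite relabel_mulpairs //; apply: relabel_nonneg => //.
rewrite (_ : mulpairs _ _ _ = fun a => (-1) ^+ shuffle (c \o tau) *:
   mulforms (numer (c \o tau)) (wsubst (Wbar (wcount (c \o tau)))) a); last first.
  exact: mulpairs_weight_rhs.
have H := nonneg_mulforms (l := numer (c \o tau))
  (@wsubst_nonneg _ _ _ _ _ (Wbar (wcount (c \o tau)))).
by move=> a; rewrite scaler_eq0 negb_or => /andP[_ /H].
Qed.

Lemma word_series_enum : word_series (enum 'I_n.+1) = weight_rhs q D (Wbar (wcount c)).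
Proof.
case: WbarP => _ /(_ n.+1 c) /funext <-; apply/funext => a.
by rewrite /word_series /weight_function /f_word [index_enum _]unlock enumT.
Qed.


Context (s t : 'I_r).
Notation m := (serre_len D (fnode s) (fnode t)).
Hypotheses (st : s != t) (mn : (m <= n)%N).
Hypotheses (c_t : c (inord 0) = t).
Hypotheses (c_s : forall j, (0 < j <= m)%N -> c (inord j) = s).

Definition serre_vars (sigma : 'S_m) : seq 'I_n.+1 :=
  [seq inord (sigma k).+1 | k <- enum 'I_m].
Definition rest_vars : seq 'I_n.+1 := [seq inord j | j <- iota m.+1 (n - m)].
(** The variable [0] is [w], of colour [t], and [1, ..., m] are the [z_i], of
    colour [s]; [w] is inserted after [p] of the permuted [z_i]. *)
Definition serre_word (p : nat) (sigma : 'S_m) : seq 'I_n.+1 :=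
  (take p (serre_vars sigma) ++ inord 0 :: drop p (serre_vars sigma)) ++ rest_vars.

Lemma serre_vars1 : serre_vars 1 = [seq inord j | j <- iota 1 m].
Proof.
have -> : iota 1 m = [seq (val k).+1 | k <- enum 'I_m].
  by rewrite (iotaDl 1 0 m) -val_enum_ord -map_comp.
by rewrite -map_comp; apply: eq_map => k /=; rewrite perm1.
Qed.

Lemma serre_word1 : serre_word 0 1 = enum 'I_n.+1.
Proof.
rewrite /serre_word take0 drop0 serre_vars1 /rest_vars.
have -> : enum 'I_n.+1 = [seq inord j | j <- iota 0 n.+1].
  rewrite -val_enum_ord -map_comp -[LHS]map_id; apply: eq_map => i /=.
  by rewrite inord_val.
by have := iotaD 1 m (n - m); rewrite subnKC // add1n /= => ->; rewrite map_cat.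
Qed.

Lemma serre_vars_perm sigma : perm_eq (serre_vars sigma) (serre_vars 1).
Proof.
have H (tau : 'S_m) : perm_eq [seq tau k | k <- enum 'I_m] (enum 'I_m).
  apply: uniq_perm; [|exact: enum_uniq|move=> i].
    by rewrite map_inj_uniq ?enum_uniq //; exact: perm_inj.
  rewrite mem_enum; apply/mapP.
  by exists ((tau^-1)%g i); rewrite ?mem_enum // permKV.
have e (tau : 'S_m) : serre_vars tau =
    [seq inord (k : 'I_m).+1 | k <- [seq tau k | k <- enum 'I_m]].
  by rewrite -map_comp.
by rewrite !e; apply/perm_map/(perm_trans (H _)); rewrite perm_sym H.
Qed.

Lemma serre_word_perm p sigma : perm_eq (serre_word p sigma) (enum 'I_n.+1).
Proof.
rewrite -serre_word1 /serre_word perm_cat2r take0 drop0 cat0s -cat1s perm_catCA.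
by rewrite cat_take_drop perm_cons serre_vars_perm.
Qed.

Lemma serre_f_word a :
  \sum_(i : 'I_m.+1 * 'S_m)
    ((-1) ^+ i.1 * qbinom (qf q D s) m i.1) *: f_word (serre_word i.1 i.2) a = 0.
Proof.
pose g (v : 'I_n.+1) := y (Curf (c v) (a v)).
have E := cur_serre_f yrel st (fun k => a (inord k.+1)) (a (inord 0)).
have mE (k : 'I_m) : (0 < k.+1 <= m)%N by rewrite ltn_ord.
have gE (sigma : 'S_m) : [seq y (Curf s (a (inord (sigma k).+1))) | k <- enum 'I_m] =
    map g (serre_vars sigma).
  by rewrite /serre_vars -map_comp; apply: eq_map => k /=; rewrite /g c_s.
transitivity (cur_serre q D s (fun k => y (Curf s k)) (fun k => y (Curf t k))
    (fun k : 'I_m => a (inord k.+1)) (a (inord 0)) * \prod_(v <- rest_vars) g v);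
  last by rewrite E mul0r.
rewrite /cur_serre.
transitivity (\sum_(p < m.+1) \sum_(sigma : 'S_m)
    ((-1) ^+ p * qbinom (qf q D s) m p) *: f_word (serre_word p sigma) a).
  by rewrite pair_bigA.
rewrite mulr_suml.
apply: eq_bigr => p _; rewrite -scaler_sumr -scalerAl mulr_suml; congr (_ *: _).
apply: eq_bigr => sigma _; rewrite gE -map_take -map_drop /f_word /serre_word big_cat.
have -> : y (Curf t (a (inord 0))) = g (inord 0) by rewrite /g c_t.
by rewrite -map_cons -map_cat big_map.
Qed.

End Words.

(** * Vanishing for a word that starts with the wheel *)

Lemma qfact_neq0 (K : fieldType) (p : K) n :
  p != 0 -> not_root_of_unity p -> qfact p n != 0.
Proof.
move=> p0 proot; apply/prodf_neq0 => i _; rewrite /qnum.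
have H k : p ^+ k.+1 - p ^- k.+1 != 0.
  rewrite subr_eq0; apply/eqP => /(congr1 (fun z => p ^+ k.+1 * z)).
  rewrite mulfV ?expf_neq0 // -exprD; apply/eqP.
  exact: proot.
by rewrite mulf_neq0 ?H // invr_eq0; have := H 0%N; rewrite !expr1.
Qed.

Lemma qbinom0 (K : fieldType) (p : K) n :
  p != 0 -> not_root_of_unity p -> qbinom p n 0 = 1.
Proof.
move=> p0 proot; rewrite /qbinom subn0 {2}/qfact big_ord0 mul1r mulfV //.
exact: qfact_neq0.
Qed.

Lemma not_root_of_unityX (K : fieldType) (q : K) d :
  (0 < d)%N -> not_root_of_unity q -> not_root_of_unity (q ^+ d).
Proof. by move=> d0 qroot k k0; rewrite -exprM; apply: qroot; rewrite muln_gt0 d0. Qed.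

(** The variables [0, 1, ..., m] of the word [c] are the path [w, z_1, ..., z_m],
    in this order. *)
Section WordVanishing.
Context (K : fieldType) (q : K) (r : nat) (D : affine_datum r).
Context (A : algType K) (M : lmodType K) (x : dj_gen r -> A) (y : cur_gen r -> A).
Context (eps : {lrmorphism A -> K^o}) (P : A -> A) (pi : A -> M).
Context (Wbar : forall nu : 'I_r -> nat, pseries nu M).
Arguments Wbar : clear implicits.
Hypotheses (q0 : q != 0) (qroot : not_root_of_unity q).
Hypotheses (yrel : cur_rel q D y) (Pproj : is_projection x y eps P).
Hypotheses (piquo : is_quotient (Ub_plus x) (Jideal x y) pi).
Hypotheses (WbarP : is_Wbar q D y P pi Wbar).
Context (n : nat) (c : 'I_n.+1 -> 'I_r).
Context (s t : 'I_r).
Notation m := (serre_len D (fnode s) (fnode t)).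
Hypotheses (st : s != t) (mn : (m <= n)%N).
Hypotheses (c_t : c (inord 0) = t).
Hypotheses (c_s : forall j, (0 < j <= m)%N -> c (inord j) = s).

Notation serre_word := (serre_word (D := D) n (s := s) (t := t)).
Notation serre_vars := (serre_vars (D := D) n (s := s) (t := t)).
Notation rest_vars := (rest_vars D n s t).

Lemma mem_serre_vars sigma v : (v \in serre_vars sigma) = (0 < v <= m)%N.
Proof.
rewrite (perm_mem (serre_vars_perm _ _)) serre_vars1; apply/mapP/idP => [[j]|vm].
  by rewrite mem_iota => jm ->; rewrite inordK //; lia.
by exists (val v); rewrite ?inord_val // mem_iota add1n ltnS.
Qed.

Lemma index_serre_word0 sigma : index (inord 0) (serre_word 0 sigma) = 0%N.
Proof. by rewrite /serre_word take0 /= eqxx. Qed.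

Lemma serre_word0E sigma : serre_word 0 sigma = inord 0 :: serre_vars sigma ++ rest_vars.
Proof. by rewrite /serre_word take0 drop0. Qed.

Lemma index_serre_wordz (sigma : 'S_m) (k : 'I_m) :
  index (inord (sigma k).+1) (serre_word 0 sigma) = k.+1.
Proof.
have inK (l : 'I_m) : (inord (sigma l).+1 : 'I_n.+1) = (sigma l).+1 :> nat.
  by rewrite inordK // ltnS (leq_trans _ mn).
rewrite serre_word0E /= -val_eqE /= inK inordK // index_cat mem_serre_vars inK ltn_ord /=.
rewrite /serre_vars (index_map (f := fun k : 'I_m => inord (sigma k).+1)).
  by rewrite index_enum_ord.
by move=> i j /(congr1 val) /=; rewrite !inK => -[] /val_inj/perm_inj.
Qed.

Lemma index_serre_word_le sigma v : (index v (serre_word 0 sigma) <= m)%N = (v <= m)%N.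
Proof.
rewrite serre_word0E /=; have [v0|v0] := eqVneq (inord 0) v.
  by rewrite -v0 inordK.
have vgt0 : (0 < v)%N.
  rewrite lt0n; apply: contraNneq v0 => v0.
  by apply/eqP/val_inj; rewrite /= inordK ?v0.
have sz : size (serre_vars sigma) = m by rewrite size_map size_enum_ord.
rewrite index_cat mem_serre_vars vgt0 sz.
have [vm|vm] := leqP v m; rewrite /=; last by lia.
have : (index v (serre_vars sigma) < size (serre_vars sigma))%N.
  by rewrite index_mem mem_serre_vars vgt0 vm.
by rewrite sz.
Qed.

Definition is_edge (p : 'I_n.+1 * 'I_n.+1) : bool :=
  (p.2 == p.1.+1 :> nat) && (p.2 <= m)%N.

(** All the denominators that occur in some [serre_word 0 sigma], except those
    of the path. The pair [(m, 0)] must stay out as well: since the wheel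
    closes up, its form [z_m - q^(alpha_s, alpha_t) w] vanishes on the wheel. *)
Definition clearing : seq ('I_n.+1 * 'I_n.+1) :=
  [seq p : 'I_n.+1 * 'I_n.+1 <- enum {: 'I_n.+1 * 'I_n.+1} |
    [&& (0 < p.2)%N, p.1 != p.2, ~~ is_edge p & (p.1 <= m)%N || (p.1 < p.2)%N]].

(** The denominators in [clearing] which the reference word does not have. *)
Definition descending : seq ('I_n.+1 * 'I_n.+1) :=
  [seq p : 'I_n.+1 * 'I_n.+1 <- enum {: 'I_n.+1 * 'I_n.+1} |
    [&& (0 < p.2)%N, (p.2 < p.1)%N & (p.1 <= m)%N]].

Definition path_pairs : seq ('I_n.+1 * 'I_n.+1) :=
  [seq (inord j, inord j.+1) | j <- iota 0 m].

Lemma mem_clearing p : (p \in clearing) =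
  [&& (0 < p.2)%N, p.1 != p.2, ~~ is_edge p & (p.1 <= m)%N || (p.1 < p.2)%N].
Proof. by rewrite mem_filter mem_enum andbT. Qed.

Lemma mem_descending p : (p \in descending) =
  [&& (0 < p.2)%N, (p.2 < p.1)%N & (p.1 <= m)%N].
Proof. by rewrite mem_filter mem_enum andbT. Qed.

Lemma mem_path_pairs p : (p \in path_pairs) = is_edge p.
Proof.
case: p => i j; apply/mapP/andP => [[k]|/= [/eqP ij jm]].
  by rewrite mem_iota => km [-> ->]; rewrite /= !inordK; lia.
exists (val i); first by rewrite mem_iota add0n /= -ij.
by rewrite inord_val /= -ij inord_val.
Qed.

Lemma path_pairs_clearing :
  perm_eq (path_pairs ++ clearing) (pairs (@nat_of_ord n.+1) ++ descending).
Proof.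
apply: uniq_perm.
- rewrite cat_uniq filter_uniq ?enum_uniq // andbT; apply/andP; split.
    rewrite map_inj_in_uniq ?iota_uniq // => i j; rewrite !mem_iota => im jm [].
    by move=> /(congr1 val) /=; rewrite !inordK; lia.
  by apply/hasPn => p; rewrite mem_clearing /= mem_path_pairs => /and4P[].
- rewrite cat_uniq pairs_uniq filter_uniq ?enum_uniq // andbT.
  by apply/hasPn => -[[i ilt] [j jlt]]; rewrite mem_descending /= mem_pairs /=; lia.
- move=> [[i ilt] [j jlt]]; rewrite !mem_cat mem_path_pairs mem_clearing.
  rewrite mem_pairs mem_descending.
  by rewrite /is_edge -val_eqE /=; lia.
Qed.

Notation kap := (den_coef q D c).
Notation ser w := (word_series y P pi c w).
Notation B := (n.+1 * n.+1)%N.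

Lemma size_pairs (rho : 'I_n.+1 -> nat) : (size (pairs rho) <= B)%N.
Proof.
by rewrite size_filter (leq_trans (count_size _ _)) // -cardE card_prod !card_ord.
Qed.


Hypothesis d_gt0 : (0 < adg D (fnode s))%N.

(** Only the words with [p = 0] and [sigma = 1] contribute to these
    coefficients, and the Serre relation has coefficient
    [qbinom (qf q D s) m 0 = 1] there. *)
Lemma serre_vanish (a : {ffun 'I_n.+1 -> int}) :
  (forall j, (0 < j <= m)%N -> a (inord j) < - B%:Z) ->
  mulpairs kap clearing (ser (enum 'I_n.+1)) a = 0.
Proof.
move=> aB; pose k (i : 'I_m.+1 * 'S_m) := (-1) ^+ i.1 * qbinom (qf q D s) m i.1.
pose G (i : 'I_m.+1 * 'S_m) := ser (serre_word i.1 i.2).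
have S0 b : \sum_i k i *: G i b = 0.
  move: b; apply: (word_series_sum Pproj piquo) => b.
  exact: (serre_f_word yrel st c_t c_s).
have : mulpairs kap clearing (fun b => \sum_i k i *: G i b) a = 0.
  have -> : (fun b => \sum_i k i *: G i b) = (fun b => 0 *: ser (enum 'I_n.+1) b).
    by apply/funext => b; rewrite S0 scale0r.
  by rewrite /mulpairs mulformsZ scale0r.
rewrite /mulpairs (mulforms_sum predT _ (fun i b => k i *: G i b)).
rewrite (bigD1 (ord0, 1%g)) //= big1 ?addr0 => [|[p sigma]].
  have -> : k (ord0, 1%g) = 1.
    rewrite /k /= mul1r; apply: qbinom0; first exact: expf_neq0.
    exact: not_root_of_unityX.
  by rewrite mulformsZ scale1r /G /= serre_word1.
rewrite xpair_eqE negb_and /= mulformsZ => pse; apply/eqP.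
have [Gcone Gden] := word_series_cone_den q0 WbarP c (serre_word_perm mn p sigma).
rewrite scaler_eq0; apply/orP; right; apply/eqP.
have [p0|p0] := eqVneq p ord0; last first.
  have [v [w vE]] : exists v w, serre_word p sigma = inord (sigma v).+1 :: w.
    rewrite /serre_word /serre_vars; case E : (enum 'I_m) => [|v w].
      have := size_enum_ord m; rewrite E /= => m0.
      by have := ltn_ord p; move: p0; rewrite -val_eqE /=; lia.
    move: p0; rewrite -val_eqE /=; case: (nat_of_ord p) => // p' _.
    by exists v; eexists.
  have vm : (0 < (sigma v).+1 <= m)%N by rewrite ltn_ord.
  apply: (cone_mulforms _ Gcone (k := 1%N)).
  apply: lt_le_trans (_ : - B%:Z <= _); last by rewrite lerN2 lez_nat size_pairs.
  apply: le_lt_trans (aB _ vm).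
  rewrite /deg (big_pred1 (inord (sigma v).+1)) // => i.
  rewrite initialE vE /=; case: eqP => [->|]; first by rewrite eqxx.
  by move=> /eqP/negPf; rewrite eq_sym => ->.
move: pse; rewrite p0 eqxx /= => sigma1; rewrite /G /=.
rewrite p0 in Gcone Gden.
have [|u [v [vu desc]]] := perm_descent (sigma := (sigma^-1)%g).
  by rewrite invg_eq1.
(* [z_(u+2)] comes before [z_(u+1)]: cut the path between them. *)
pose T : pred 'I_n.+1 := fun i => (u.+1 < i <= m)%N.
have inK (i : 'I_m) : (inord i.+1 : 'I_n.+1) = i.+1 :> nat.
  by rewrite inordK // ltnS (leq_trans _ mn).
have idx (i : 'I_m) :
    index (inord i.+1 : 'I_n.+1) (serre_word 0 sigma) = ((sigma^-1)%g i).+1.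
  by rewrite -{1}(permKV sigma i) index_serre_wordz.
apply: (supp_ge_cut (T := T) (den_coef_neq0 _ q0 _) _ _ Gcone Gden).
- by rewrite filter_uniq ?enum_uniq.
- move=> [i j] /= ij Tij; rewrite mem_clearing /=.
  have j0 : (0 < j)%N.
    rewrite lt0n; apply: contraTneq ij => j0; rewrite -leqNgt.
    have -> : j = inord 0 by apply/val_inj; rewrite /= inordK.
    by rewrite index_serre_word0.
  have i_ne_j : i != j by apply: contraNneq Tij => ->.
  have ijm : (m < i)%N -> (m < j)%N.
    rewrite !ltnNge -!(index_serre_word_le sigma) -!ltnNge => im.
    exact: ltn_trans ij.
  rewrite j0 i_ne_j /=; apply/andP; split; last first.
    by move: Tij ijm; rewrite /T; lia.
  apply/negP => /andP[/= /eqP ji jm]; move: Tij; rewrite /T ji.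
  have [iu _|iu] := eqVneq (i : nat) u.+1; last by lia.
  have ei : i = inord u.+1 by apply/val_inj; rewrite /= inK.
  have ej : j = inord v.+1 by apply/val_inj; rewrite /= inK ji iu vu.
  by move: ij; rewrite ei ej !idx ltnS ltnNge (ltnW desc).
- have vm : (0 < v.+1 <= m)%N by rewrite ltn_ord.
  rewrite /deg (bigD1 (inord v.+1)) /=; last by rewrite /T inK; lia.
  apply: lt_le_trans (_ : - B%:Z <= _); last by rewrite lerN2 lez_nat size_pairs.
  rewrite -[X in _ < X]addr0; apply: ltr_leD; first exact: aB.
  apply: sumr_le0 => i /andP[/andP[ui im] _].
  have := aB i; rewrite inord_val => /(_ _); lia.
Qed.

Hypothesis form_ss : fform D s s = 2 * (adg D (fnode s))%:Z.
Hypothesis form_ts : fform D t s = (adg D (fnode s))%:Z * (1 - m%:Z).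

Notation W := (wsubst (Wbar (wcount c))).

Definition on_wheel (u : 'I_n.+1 -> K) : Prop :=
  forall j, (j < m)%N ->
    u (inord j) = kap (inord j, inord j.+1) * u (inord j.+1).

(** What is left beside Wbar after multiplying the reference word by
    [clearing] and by the forms of the path. *)
Definition residual_forms : seq (K * ('I_n.+1 * 'I_n.+1)) :=
  [seq (kap p, p) | p <- descending] ++ numer c.

(** The point may have zero coordinates, where the rescaling in [wheel_residue]
    is not available; but the coordinates themselves are among the forms. *)
Lemma residual_forms_wheel d u : on_wheel u ->
  (\prod_(f <- residual_forms) form_at u f) *: ev d u W = 0.
Proof.
move=> uH; have W0 : nonneg W by exact: wsubst_nonneg.
have [/forallP u0|/forallPn[i /negPn/eqP ui]] := boolP [forall i, u i != 0];
  last first.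
  suff -> : \prod_(f <- residual_forms) form_at u f = 0 by rewrite scale0r.
  apply/eqP; rewrite prodf_seq_eq0; apply/hasP; exists (0, (i, i)).
    by rewrite !mem_cat map_f ?mem_enum ?orbT.
  by rewrite /form_at /= ui mulr0 subrr.
pose Y := mulpairs kap clearing (ser (enum 'I_n.+1)).
pose ke j := kap (inord j, inord j.+1).
have YE : mulforms (edges ke m) Y =
    (fun a => (-1) ^+ shuffle c *: mulforms residual_forms W a).
  have -> : mulforms (edges ke m) Y = mulpairs kap path_pairs Y.
    by rewrite /mulpairs /path_pairs -map_comp.
  rewrite /Y -mulpairs_cat (mulpairs_perm _ _ path_pairs_clearing) mulpairs_cat mulpairsC.
  rewrite (word_series_enum WbarP) -wpairsE mulpairs_weight_rhs // /mulpairs mulformsZ.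
  by rewrite /residual_forms mulforms_cat.
have F0 : nonneg (fun a => (-1) ^+ shuffle c *: mulforms residual_forms W a).
  by move=> a; rewrite scaler_eq0 negb_or => /andP[_ /(nonneg_mulforms W0)].
have evE : ev (size residual_forms + d) u
    (fun a => (-1) ^+ shuffle c *: mulforms residual_forms W a) = 0.
  rewrite -YE; apply: (@wheel_residue _ _ _ m B) => //; first 1 last.
  - exact: serre_vanish.
  - by rewrite YE.
  move=> k a aB; rewrite /Y.
  rewrite (word_series_enum WbarP).
  have cW : cone (@nat_of_ord n.+1) (size (wpairs n.+1))
    (weight_rhs q D (Wbar (wcount c))) by exact: cone_weight_rhs.
  apply: (cone_mulforms _ cW (k := k)).
  apply: lt_le_trans aB _; rewrite lerN2 lez_nat; exact: size_pairs.
have : (-1) ^+ shuffle c *: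
    ev (size residual_forms + d) u (mulforms residual_forms W) = 0.
  rewrite -[RHS]evE /ev scaler_sumr; apply: eq_bigr => b _.
  by rewrite !scalerA mulrC.
by rewrite ev_mulforms // => /eqP; rewrite scaler_eq0 signr_eq0 => /eqP.
Qed.

(** The point of the wheel with [w = 1] and all the variables off the path zero. *)
Definition wheel_point (i : 'I_n.+1) : K :=
  if (i == 0 :> nat) then 1 else
  if (i <= m)%N then q ^ ((adg D (fnode s))%:Z * (m%:Z + 1 - 2 * i%:Z)) else 0.

Lemma expfz_inj (a b : int) : q ^ a = q ^ b -> a = b.
Proof.
wlog ab : a b / a <= b.
  by move=> H E; case/orP: (le_total a b) => ?; [exact: H|apply/esym/H].
move=> E; have [k bE] : exists k : nat, b = a + k%:Z.
  by exists `|b - a|%N; lia.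
move: E; rewrite bE expfzDr // -[LHS]mulr1 => /(mulfI (expfz_neq0 _ q0)) /esym/eqP.
by case: k bE => [|k] _; [rewrite addr0|rewrite (negPf (qroot (ltn0Sn k)))].
Qed.


Lemma kap_path j : (j < m)%N -> kap (inord j, inord j.+1) =
  q ^ ((adg D (fnode s))%:Z * (if j == 0%N then 1 - m%:Z else 2)).
Proof.
move=> jm; rewrite /den_coef /= (c_s (j := j.+1)) ?jm //; case: eqP => [->|j0].
  by rewrite c_t form_ts.
by rewrite c_s ?form_ss 1?mulrC //; lia.
Qed.

Lemma wheel_point_on_wheel : on_wheel (wheel_point).
Proof.
move=> j jm; rewrite kap_path // /wheel_point !inordK; [|lia|lia].
rewrite /= ltnW // jm -expfzDr // -mulrDr.
case: eqP => [->|_]; last by congr (q ^ (_ * _)); lia.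
by rewrite (_ : _ + _ = 0) ?mulr0 ?expr0z //; lia.
Qed.

Lemma wheel_point_neq0 (i : 'I_n.+1) : (i <= m)%N -> wheel_point i != 0.
Proof.
by move=> im; rewrite /wheel_point im; case: ifP; rewrite ?oner_neq0 ?expfz_neq0.
Qed.

Definition coord_point (k i : 'I_n.+1) : K := (i == k)%:R.

Lemma coord_point_on_wheel (k : 'I_n.+1) : (m < k)%N -> on_wheel (coord_point k).
Proof.
move=> mk j jm; rewrite /coord_point -!val_eqE /= !inordK; [|lia|lia].
have -> : (j == k) = false by lia.
have -> : (j.+1 == k) = false by lia.
by rewrite mulr0.
Qed.

Lemma c_sv (i : 'I_n.+1) : (0 < i <= m)%N -> c i = s.
Proof. by move=> im; rewrite -(inord_val i) c_s. Qed.

(** A form with a variable off the path is nonzero at a coordinate vector, which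
    lies on the wheel. On the path, the coordinates of [wheel_point] are
    powers of [q] with distinct exponents, and so are the two terms of the
    forms in [descending]. *)
Lemma residual_forms_witness f : f \in residual_forms ->
  exists2 v, on_wheel v & form_at v f != 0.
Proof.
rewrite !mem_cat => /or3P[] /mapP[].
- move=> [i j]; rewrite mem_descending /= => ijm ->.
  exists wheel_point; first exact: wheel_point_on_wheel.
  rewrite /form_at /= /den_coef /= !c_sv ?form_ss; [|lia|lia].
  rewrite /wheel_point; have -> : (i == 0 :> nat) = false by lia.
  have -> : (j == 0 :> nat) = false by lia.
  have -> : (i <= m)%N by lia.
  have -> : (j <= m)%N by lia.
  rewrite -expfzDr // subr_eq0; apply/eqP => /expfz_inj; nia.
- move=> [i j]; rewrite mem_filter mem_pairs /= => /andP[/eqP cij ij] ->.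
  have [jm|jm] := leqP j m; last first.
    exists (coord_point j); first exact: coord_point_on_wheel.
    rewrite /form_at /coord_point /= eqxx mul1r -val_eqE /=.
    have -> : (i == j :> nat) = false by lia.
    by rewrite sub0r oppr_eq0 oner_neq0.
  exists wheel_point; first exact: wheel_point_on_wheel.
  have i0 : (0 < i)%N.
    rewrite lt0n; apply/eqP => i0.
    have ei : i = inord 0 by apply/val_inj; rewrite /= inordK.
    move: cij; rewrite ei c_t c_sv; last by rewrite jm (leq_ltn_trans _ ij).
    by move=> ts; move: st; rewrite ts eqxx.
  rewrite /form_at /= mul1r /wheel_point; have -> : (i == 0 :> nat) = false by lia.
  have -> : (j == 0 :> nat) = false by lia.
  have -> : (i <= m)%N by lia.
  rewrite jm subr_eq0; apply/eqP => /expfz_inj; nia.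
- move=> i _ ->; rewrite /form_at /=; have [im|im] := leqP i m.
    exists wheel_point; first exact: wheel_point_on_wheel.
    by rewrite mul0r subr0 wheel_point_neq0.
  exists (coord_point i); first exact: coord_point_on_wheel.
  by rewrite mul0r subr0 /coord_point eqxx oner_neq0.
Qed.

Lemma word_vanish d u : on_wheel u -> ev d u W = 0.
Proof.
move=> uH; apply: (cancel_forms q0 qroot (S := on_wheel) (l := residual_forms)) uH.
- move=> v w z vH wH j jm; rewrite vH // wH //; ring.
- exact: residual_forms_witness.
- exact: residual_forms_wheel.
Qed.

End WordVanishing.

(** * Sign of the Cartan matrix *)

Section CartanSign.
Context (K : numFieldType) (g : vectType K) (br : g -> g -> g).
Hypothesis brL : is_lie_bracket br.

Lemma br_lin x c u v : br x (c *: u + v) = c *: br x u + br x v.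
Proof. by case: brL => + _ _ _ => /(_ x) /(_ c u v). Qed.

Lemma br0 x : br x 0 = 0.
Proof.
have := br_lin x 1 0 0; rewrite scaler0 addr0 scale1r => /eqP.
by rewrite -subr_eq subrr eq_sym => /eqP.
Qed.

Lemma brZ x c u : br x (c *: u) = c *: br x u.
Proof. by rewrite -[c *: u]addr0 br_lin br0 addr0. Qed.

Lemma brN x u : br x (- u) = - br x u.
Proof. by rewrite -scaleN1r brZ scaleN1r. Qed.

Lemma brD x u v : br x (u + v) = br x u + br x v.
Proof. by rewrite -[u]scale1r br_lin !scale1r. Qed.

Lemma brC x y : br x y = - br y x.
Proof.
case: brL => _ brl alt _.
have brDl a b z : br (a + b) z = br a z + br b z.
  by have := brl z 1 a b; rewrite /= !scale1r.
have := alt (x + y); rewrite brD !brDl !alt add0r addr0 => /eqP.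
by rewrite addrC addr_eq0 => /eqP.
Qed.

Lemma brNl u w : br (- u) w = - br u w.
Proof. by rewrite brC brN opprK brC. Qed.

Lemma br_jacobi x y z : br x (br y z) = br (br x y) z + br y (br x z).
Proof.
case: brL => _ _ _ /(_ x y z) /eqP; rewrite addrAC -addrA addr_eq0 => /eqP ->.
by rewrite (brC z (br x y)) (brC z x) brN opprD !opprK.
Qed.

Context (r : nat) (D : affine_datum r) (e f h : 'I_r -> g).
Hypothesis chev : is_chevalley br D e f h.

(** As [f_i] kills [e_j], the vector [e_j] is a lowest weight vector of weight
    [a_ij] for the copy of sl2 at [i]. If [a_ij] were positive,
    all [ad(e_i)^k e_j] would be nonzero, with distinct weights, in a space of
    finite dimension. *)
Lemma cartan_le0 i j : i != j -> acm D (fnode i) (fnode j) <= 0.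
Proof.
move=> ij; case: chev => hfree [a2 hh] he ef _; rewrite leNgt; apply/negP.
set a := acm D _ _ => a_gt0.
have ejN0 : e j != 0.
  apply/eqP => ej0; have := ef j j; rewrite eqxx ej0 brC br0 oppr0 => /esym hj.
  have : 0 \in [seq h i | i <- enum 'I_r].
    by rewrite -hj; apply/map_f; rewrite mem_enum.
  by move=> /(free_not0 hfree); rewrite eqxx.
pose v k := iter k (br (e i)) (e j).
have vS k : v k.+1 = br (e i) (v k) by rewrite /v iterS.
have hv k : br (h i) (v k) = (a + 2 * k%:Z)%:~R *: v k.
  elim: k => [|k IH]; first by rewrite mulr0 addr0; case: (he i j).
  rewrite vS br_jacobi IH brZ.
  case: (he i i) => -> _; rewrite a2 brC brZ (brC (v k)) scalerN opprK -scalerDl.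
  by congr (_ *: _); rewrite -intrD; congr (_%:~R); lia.
have fe : br (f i) (e i) = - h i by rewrite brC ef eqxx.
have fv0 : br (f i) (v 0%N) = 0 by rewrite brC ef eq_sym (negPf ij) oppr0.
have fv k : br (f i) (v k.+1) = - (k.+1%:Z * (a + k%:Z))%:~R *: v k.
  elim: k => [|k IH]; rewrite vS br_jacobi fe brNl hv ?fv0 ?br0 ?addr0.
    by rewrite -scaleNr; congr (- _%:~R *: _); lia.
  rewrite IH brZ -vS -scaleNr -scalerDl; congr (_ *: _).
  by rewrite -opprD -intrD; congr (- _%:~R); ring.
have vN0 k : v k != 0.
  elim: k => [|k IH]; first exact: ejN0.
  apply/eqP => vk; have := fv k; rewrite vk br0 => /esym/eqP.
  rewrite scaler_eq0 (negPf IH) orbF oppr_eq0 intr_eq0 mulf_eq0.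
  by move=> /orP[] /eqP; move: a_gt0; rewrite -/a; lia.
have vindep N (x : nat -> K) : \sum_(k < N) x k *: v k = 0 ->
    forall k, (k < N)%N -> x k = 0.
  elim: N x => // N IH x xN.
  have lt0 k : (k < N)%N -> x k = 0.
    move=> kN; have := IH (fun k => (k%:R - N%:R) * x k) _ k kN.
    move=> H; have /eqP : (k%:R - N%:R) * x k = 0.
      apply: H; have : br (h i) (\sum_(k < N.+1) x k *: v k) = 0 by rewrite xN br0.
      rewrite (big_morph _ (brD (h i)) (br0 (h i))).
      move=> /(congr1 (fun z => z - (a + 2 * N%:Z)%:~R *: \sum_(k < N.+1) x k *: v k)).
      rewrite {2}xN scaler0 subr0 scaler_sumr -sumrB big_ord_recr /=.
      rewrite brZ hv scalerA scalerA [X in _ + X](_ : _ = 0); last first.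
        by rewrite mulrC subrr.
      rewrite addr0 => E; apply: (@scalerI _ _ (2%:R : K)); first by rewrite pnatr_eq0.
      rewrite scaler0 -[RHS]E scaler_sumr; apply: eq_bigr => l _.
      rewrite brZ hv !scalerA -scalerBl; congr (_ *: _).
      by rewrite !intrD !intrM -!pmulrn; ring.
    rewrite mulf_eq0 subr_eq0 eqr_nat => /orP[/eqP kN'|/eqP //].
    by move: kN; rewrite kN' ltnn.
  move=> k; rewrite ltnS leq_eqVlt => /predU1P[->|]; last exact: lt0.
  move: xN; rewrite big_ord_recr /= big1 ?add0r => [/eqP|l _].
    by rewrite scaler_eq0 (negPf (vN0 N)) orbF => /eqP.
  by rewrite lt0 ?scale0r.
pose N := (\dim (fullv : {vspace g})).+1.
have : free [tuple v l | l < N].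
  apply/freeP => x x0 l; pose x' k := if insub k is Some l then x l else 0.
  have x'E (l0 : 'I_N) : x' l0 = x l0 by rewrite /x' valK.
  rewrite -x'E; apply: vindep (ltn_ord l); rewrite -[RHS]x0.
  by apply: eq_bigr => l0 _; rewrite x'E -tnth_nth tnth_mktuple.
rewrite /free size_tuple => /eqP dN.
by have := dimvS (subvf <<[tuple v l | l < N]>>); rewrite dN /N ltnn.
Qed.

End CartanSign.

(** * Relabelling the variables of the symmetric series *)

Section Relabelling.
Context (r : nat).

(** The multiplicities [nu'] and [nu] are kept apart because the multiplicities
    of a word are equal to the given ones only propositionally. *)
Lemma symmetric_relabel (M : Type) (Wb : forall nu : 'I_r -> nat, pseries nu M)
    (nu nu' : 'I_r -> nat) (psi : uvar nu' -> uvar nu) (a : {ffun uvar nu -> nat}) :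
  nu' = nu -> group_symmetric (@Wb nu) -> injective psi ->
  (forall v, tag (psi v) = tag v) ->
  @Wb nu' [ffun v => a (psi v)] = @Wb nu a.
Proof.
move=> E; subst nu' => sym psi_inj psi_tag.
have ex v : exists j : 'I_(nu (tag v)), psi v == uvarE j.
  case: (psi v) (psi_tag v) => s j /= sE.
  by move: j; rewrite sE => j; exists j.
pose sg s (j : 'I_(nu s)) : 'I_(nu s) := xchoose (ex (uvarE j)).
have sgE s (j : 'I_(nu s)) : psi (uvarE j) = uvarE (sg s j).
  exact/eqP/(xchooseP (ex (uvarE j))).
have sg_inj s : injective (sg s).
  move=> j j' sjj; have : psi (uvarE j) = psi (uvarE j') by rewrite !sgE sjj.
  by move=> /psi_inj /eqP; rewrite eq_Tagged => /eqP.
rewrite -[RHS](sym (fun s => perm (@sg_inj s))); congr (@Wb nu _).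
apply/ffunP => -[s j]; rewrite !ffunE /= permE.
by rewrite -sgE.
Qed.

Lemma wpos_tag n (c : 'I_n -> 'I_r) (v : uvar (wcount c)) : c (wpos v) = tag v.
Proof. by have := enum_valP (tagged v); rewrite inE => /eqP. Qed.

Lemma wpos_inj n (c : 'I_n -> 'I_r) : injective (@wpos r n c).
Proof.
move=> [s j] [s' j'] E; have := wpos_tag (Tagged (fun s => 'I_(wcount c s)) j).
rewrite E wpos_tag /= => ss; subst s'.
by rewrite (enum_val_inj (E : enum_val j = enum_val j')).
Qed.

Lemma wcount_bij n (nu : 'I_r -> nat) (phi : 'I_n -> uvar nu) :
  bijective phi -> wcount (tag \o phi) = nu.
Proof.
move=> phi_bij; apply/funext => s; rewrite /wcount.
rewrite -(card_imset _ (bij_inj phi_bij)).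
rewrite -[RHS]card_ord -cardsT -(card_imset _ (f := @uvarE r nu s)); last first.
  by move=> j j' /eqP; rewrite eq_Tagged => /eqP.
apply: eq_card => -[s' j]; apply/imsetP/imsetP => [[i si E]|[l _ ->]].
  move: si; rewrite inE /= -E /= => /eqP ss; subst s'.
  by exists j; rewrite ?inE.
have [g _ gK] := phi_bij; exists (g (uvarE l)); rewrite ?gK //.
by rewrite inE /= gK.
Qed.

(** Any labelling of the positions of a word by the variables of Wbar that
    respects the colours may be used, since it differs from the increasing one
    by permutations within the colours. *)
Lemma homog_eval_word (K : fieldType) (M : lmodType K)
    (Wb : forall nu : 'I_r -> nat, pseries nu M) (nu : 'I_r -> nat) n
    (phi : 'I_n.+1 -> uvar nu) d u :
  group_symmetric (@Wb nu) -> bijective phi ->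
  homog_eval (@Wb nu) d u =
  ev d (u \o phi) (wsubst (@Wb (wcount (tag \o phi)))).
Proof.
move=> sym phi_bij; have [g gK Kg] := phi_bij.
pose h (b : {ffun 'I_n.+1 -> 'I_d.+1}) : {ffun uvar nu -> 'I_d.+1} :=
  [ffun v => b (g v)].
have h_bij : bijective h.
  exists (fun a : {ffun uvar nu -> 'I_d.+1} => [ffun i => a (phi i)]) => a;
    apply/ffunP => z.
    by rewrite !ffunE gK.
  by rewrite !ffunE Kg.
rewrite /homog_eval /ev (reindex h (onW_bij _ h_bij)).
apply: eq_big => [b|b _].
  rewrite (reindex phi (onW_bij _ phi_bij)); congr (_ == _).
  by apply: eq_bigr => i _; rewrite ffunE gK.
congr (_ *: _).
  rewrite (reindex phi (onW_bij _ phi_bij)).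
  by apply: eq_bigr => i _; rewrite ffunE gK.
rewrite /wsubst; have -> : [forall i, 0 <= exponent b i].
  by apply/forallP => i; rewrite ffunE.
rewrite -(@symmetric_relabel _ Wb nu (wcount (tag \o phi))
  (phi \o @wpos r n.+1 (tag \o phi))) //.
- by congr (Wb _ _); apply/ffunP => v; rewrite !ffunE gK.
- exact: wcount_bij.
- by apply: inj_comp; [exact: bij_inj|exact: wpos_inj].
- by move=> v; rewrite -[RHS]wpos_tag.
Qed.

End Relabelling.

(** * Reduction to a word that starts with the wheel *)

Local Open Scope complex_scope.

Theorem proposition4p3 (R : realType) (q : R[i]) (r : nat)
  (g : vectType R[i]) (br : g -> g -> g) (e f h : 'I_r -> g)
  (D : affine_datum r)
  (U : algType R[i]) (x : dj_gen r -> U) (y : cur_gen r -> U)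
  (eps : {lrmorphism U -> R[i]^o}) (P : U -> U)
  (M : lmodType R[i]) (pi : U -> M)
  (Wbar : forall nu : 'I_r -> nat, pseries nu M) :
  q != 0 -> not_root_of_unity q ->
  is_simple_lie br -> is_chevalley br D e f h -> is_untwisted_affine br D h ->
  is_presented x (@dj_rel _ q _ D) -> is_presented y (@cur_rel _ q _ D) ->
  identified D br e h x y ->
  is_counit x eps -> is_projection x y eps P ->
  is_quotient (Ub_plus x) (Jideal x y) pi ->
  is_Wbar q D y P pi Wbar ->
  forall (nu : 'I_r -> nat) (s t : 'I_r), s != t ->
  forall (k : 'I_(serre_len D (fnode s) (fnode t)) -> 'I_(nu s))
    (l : 'I_(nu t)),
    injective k ->
    restriction_zero (Wbar nu) (Hsub q k l).
Proof.
move=> q0 qroot [brL _ _] chev aff _ [yrel _] _ _ Pproj piquo WbarP nu s t st k l.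
move=> k_inj d u uH; set m := serre_len D (fnode s) (fnode t) in k k_inj uH.
have a_le0 : acm D (fnode s) (fnode t) <= 0 by apply: (cartan_le0 brL chev).
have mE : m%:Z = 1 - acm D (fnode s) (fnode t) by rewrite /m /serre_len; lia.
have [[adg_bd _] formC _ _ _] := aff.
have d_gt0 : (0 < adg D (fnode s))%N by case/andP: (adg_bd (fnode s)).
have form_ss : fform D s s = 2 * (adg D (fnode s))%:Z.
  by case: chev => _ [a2 _] _ _ _; rewrite /fform /Defs.form a2 mulrC.
have form_ts : fform D t s = (adg D (fnode s))%:Z * (1 - m%:Z).
  by rewrite /fform formC mE /Defs.form; congr (_ * _); lia.
(* The word: [l], then [k_1, ..., k_m], then the other variables in any order. *)
pose front := uvarE l :: [seq uvarE (k i) | i <- enum 'I_m].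
pose vs := front ++ [seq v <- enum {: uvar nu} | v \notin front].
have ufront : uniq front.
  rewrite /= map_inj_uniq ?enum_uniq ?andbT => [|i j /eqP]; last first.
    by rewrite eq_Tagged => /eqP /k_inj.
  apply/mapP => -[i _ E]; have := congr1 (fun v : uvar nu => tag v) E => /= ts.
  by move: st; rewrite ts eqxx.
have uvs : uniq vs.
  rewrite cat_uniq ufront filter_uniq ?enum_uniq // andbT.
  by apply/hasPn => v; rewrite mem_filter => /andP[].
have in_vs v : v \in vs.
  by rewrite mem_cat mem_filter mem_enum andbT; case: (v \in front).
have size_front : size front = m.+1 by rewrite /= size_map size_enum_ord.
pose n := (size vs).-1.
have size_vs : size vs = n.+1 by rewrite /n /vs /= .
have mn : (m <= n)%N by rewrite -ltnS -size_vs size_cat size_front leq_addr.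
pose phi (i : 'I_n.+1) := nth (uvarE l) vs i.
have phi_bij : bijective phi.
  exists (fun v => inord (index v vs)) => [i|v].
    have ivs : (i < size vs)%N by rewrite size_vs.
    apply/val_inj; have := index_uniq (uvarE l) ivs uvs => /= iE.
    by rewrite /phi iE inordK.
  by rewrite /phi inordK -?size_vs ?index_mem // nth_index.
have phi0 : phi (inord 0) = uvarE l by rewrite /phi inordK.
have phiS j (jm : (j < m)%N) : phi (inord j.+1) = uvarE (k (Ordinal jm)).
  rewrite /phi inordK; last by rewrite ltnS (leq_trans jm).
  rewrite nth_cat size_front ltnS jm /= (nth_map (Ordinal jm)) ?size_enum_ord //.
  by rewrite -[j in X in k X]/(val (Ordinal jm)) nth_ord_enum.
have c_s j : (0 < j <= m)%N -> (tag \o phi) (inord j) = s.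
  by case: j => // j /andP[_ jm]; rewrite /= phiS.
rewrite (homog_eval_word (Wb := Wbar) d u (proj1 WbarP nu) phi_bij).
apply: (word_vanish q0 qroot yrel Pproj piquo WbarP st mn) => //.
  by rewrite /= phi0.
(* The exponent in the definition of the subspace is even. *)
have uHE (j : 'I_m) : u (uvarE l) =
    q ^ ((2 * j%:Z - (m%:Z - 1)) * (adg D (fnode s))%:Z) * u (uvarE (k j)).
  rewrite [LHS](uH j) -/m form_ss; congr (q ^ _ * _).
  by rewrite (mulrC 2 (Posz (adg _ _))) mulrA mulzK.
move=> j jm; rewrite /den_coef /= phiS.
case: j jm => [|j] jm.
  by rewrite phi0 /= form_ts (uHE (Ordinal jm)); congr (q ^ _ * _); rewrite /=; ring.
have jm' := ltnW jm; rewrite (phiS j jm') /= form_ss.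
apply: (mulfI (expfz_neq0 ((2 * j%:Z - (m%:Z - 1)) * (adg D (fnode s))%:Z) q0)).
rewrite -(uHE (Ordinal jm')) (uHE (Ordinal jm)) mulrA -expfzDr //.
by congr (q ^ _ * _); rewrite /=; lia.
Qed.
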